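(* Let $c_1,c_2\in\mathfrak o^\times$ and $\alpha,\beta\in F^\times$. Let $\eta$ be a character of $F^\times$ with conductor exponent $a(\eta)\in\{0,1\}$. Then $$Z(s,W_{d_{\alpha,\beta}f^\pm_{\rm min}},\eta)=\begin{cases}(1-q^{-1})^{-1}q^{s+7/2}|\beta|^{1/2-s}\eta(\beta\varpi c_2)^{-1}&\text{if }\alpha\in\varpi^{-1}c_1^{-1}(1+\mathfrak p),\\0&\text{otherwise.}\end{cases}$$
   Context: $F$ is a non-archimedean local field of characteristic zero with ring of integers $\mathfrak o$, maximal ideal $\mathfrak p$, uniformizer $\varpi$, $q=\#(\mathfrak o/\mathfrak p)$, $|\varpi|=q^{-1}$. $\psi$ is a character of $F$ trivial on $\mathfrak o$ but not on $\mathfrak p^{-1}$, and $\psi_0(x)=\psi(\varpi^{-1}x)$. The Haar measures satisfy $\mathrm{vol}(\mathfrak o,dx)=1$ and $\mathrm{vol}(\mathfrak o^\times,d^\times x)=1$. The conductor exponent $a(\eta)$ of a character $\eta$ of $F^\times$ is the least $n\ge0$ such that $\eta$ is trivial on $1+\mathfrak p^n$ (with $1+\mathfrak p^0=\mathfrak o^\times$). $G=\mathrm{GSp}_4(F)=\{g\in\mathrm{GL}_4(F):{}^tgJg=\mu(g)J,\ \mu(g)\in F^\times\}$ with $J=\begin{bmatrix}&&&1\\&&1\\&-1\\-1\end{bmatrix}$; $Z$ is its center. Let $K'=G\cap\begin{bmatrix}1+\mathfrak p&\mathfrak o&\mathfrak o&\mathfrak o\\\mathfrak p&1+\mathfrak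 p&\mathfrak o&\mathfrak o\\\mathfrak p&\mathfrak p&1+\mathfrak p&\mathfrak o\\\mathfrak p&\mathfrak p&\mathfrak p&1+\mathfrak p\end{bmatrix}$ and $H=ZK'$. For a fixed $t\in\mathfrak o^\times$, $\chi=\chi_{1,1,t}:H\to\mathbb C^\times$ is $\chi(zk)=\psi_0(k_{12}+k_{23}+t\varpi^{-1}k_{41})$ for $z\in Z$, $k\in K'$. Let $g_\chi=\begin{bmatrix}0&0&1&0\\0&0&0&-1\\-\varpi/t&0&0&0\\0&\varpi/t&0&0\end{bmatrix}$, $H'=H\sqcup g_\chi H$, and $\chi^\pm:H'\to\mathbb C^\times$, $\chi^\pm(h)=\chi(h)$, $\chi^\pm(g_\chi h)=\pm\chi(h)$ for $h\in H$. Then $\sigma_\chi^\pm=\text{c-Ind}_{H'}^G(\chi^\pm)$, realized on functions $f:G\to\mathbb C$ with $f(hg)=\chi^\pm(h)f(g)$ for $h\in H'$, with $G$ acting by right translation. The minimal vector $f^\pm_{\rm min}$ equals $\chi^\pm$ on $H'$ and zero outside $H'$. The inner product is $\langle f_1,f_2\rangle=\mathrm{vol}(Z\backslash H')^{-1}\int_{Z\backslash G}f_1(x)\overline{f_2(x)}\,dx$. For $\alpha,\beta\in F^\times$, $d_{\alpha,\beta}=\mathrm{diag}(\alpha^2\beta,\alpha\beta,\alpha,1)$. $U$ is the group of matrices $u=\begin{bmatrix}1&a\\&1\\&&1&-a\\&&&1\end{bmatrix}\begin{bmatrix}1&&b&c\\&1&e&b\\&&1\\&&&1\end{bmatrix}$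 with measure $du=da\,db\,dc\,de$, and $\psi_{c_1,c_2}(u)=\psi(c_1a+c_2e)$. For $\phi$ in $\sigma_\chi^\pm$ the Whittaker function is $$W_\phi(g)=\int_U\langle u g\phi,\ d_{\varpi^{-1}c_1^{-1},\varpi^{-1}c_2^{-1}}f^\pm_{\rm min}\rangle\,\psi_{c_1,c_2}^{-1}(u)\,du.$$ The Novodvorsky zeta integral of a Whittaker function $W$ and a character $\eta$ of $F^\times$ is $$Z(s,W,\eta)=\int_{F^\times}\int_FW\Big(\begin{bmatrix}\gamma\\&\gamma\\&x&1\\&&&1\end{bmatrix}\Big)|\gamma|^{s-\frac32}\eta(\gamma)\,dx\,d^\times\gamma.$$ *)

(* Defs.v *)
From HB Require Import structures.
From mathcomp Require Import all_boot all_order all_algebra.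
From mathcomp Require Import all_classical all_reals all_analysis.
From mathcomp Require Import complex.
From mathcomp Require Import ring.

Set Implicit Arguments.
Unset Strict Implicit.
Unset Printing Implicit Defensive.

Import Order.TTheory GRing.Theory Num.Theory.

Local Open Scope classical_set_scope.
Local Open Scope ring_scope.

(* [resq] is the cardinality of o/p, whose elements are the cosets x + p with x
   in o.  The axiom [uniformizerP] says that p is principal (the valuation is
   discrete and nontrivial) and that the absolute value is normalized by
   |w| = 1/q on generators of p. *)
Record nonarchimedeanLocalField (R : realType) := NonarchimedeanLocalField {
  lf_field : fieldType;
  lf_abs : lf_field -> R;
  resq : nat;
  lf_abs_ge0 : forall x, 0 <= lf_abs x;
  lf_abs_eq0 : forall x, lf_abs x = 0 <-> x = 0;
  lf_absM : forall x y, lf_abs (x * y) = lf_abs x * lf_abs y;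
  lf_abs_ultra : forall x y, lf_abs (x + y) <= Num.max (lf_abs x) (lf_abs y);
  lf_char0 : [pchar lf_field] =i pred0;
  resqP : ([set [set y | (lf_abs (y - x) < 1)%R] | x in [set x | (lf_abs x <= 1)%R]]
            #= `I_resq)%card;
  uniformizerP : exists2 w, lf_abs w = resq%:R^-1 &
    [set x | lf_abs x < 1] = [set w * y | y in [set y | lf_abs y <= 1]];
  lf_complete : forall u : nat -> lf_field,
    (forall e : R, 0 < e -> exists N, forall m n, (N <= m)%N -> (N <= n)%N ->
       lf_abs (u m - u n) < e) ->
    exists l, forall e : R, 0 < e -> exists N, forall n, (N <= n)%N ->
      lf_abs (u n - l) < e
}.

Definition lf_sort (R : realType) (F : nonarchimedeanLocalField R) : Type :=
  lf_field F.
Coercion lf_sort : nonarchimedeanLocalField >-> Sortclass.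

HB.instance Definition _ (R : realType) (F : nonarchimedeanLocalField R) :=
  GRing.Field.on (lf_sort F).
HB.instance Definition _ (R : realType) (F : nonarchimedeanLocalField R) :=
  isPointed.Build (lf_sort F) (0 : lf_field F).

Section AbsoluteValue.
Context {R : realType} {F : nonarchimedeanLocalField R}.

Definition vabs (x : F) : R := lf_abs (x : lf_field F).

Lemma vabsB (x y : F) : vabs (x - y) = vabs (y - x).
Proof.
have abs1 : vabs 1 = 1.
  have : vabs 1 * vabs 1 = vabs 1 * 1 by rewrite mulr1 -[LHS]lf_absM mulr1.
  apply: mulfI; apply/eqP => /lf_abs_eq0/eqP; exact/negP/oner_neq0.
have absN1 : vabs (- 1) = 1.
  have : vabs (- 1) ^+ 2 = 1 by rewrite expr2 -[LHS]lf_absM mulrNN mulr1.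
  by move=> /eqP; rewrite sqrf_eq1 => /orP[/eqP//|/eqP abs_lt0];
    have := lf_abs_ge0 (- 1 : lf_field F); rewrite -/(vabs _) abs_lt0 oppr_ge0 ler10.
by rewrite -opprB -mulN1r [LHS]lf_absM -/(vabs _) absN1 mul1r.
Qed.

Fact vdist0 (x : F) : vabs (x - x) = 0.
Proof. by apply/lf_abs_eq0; rewrite subrr. Qed.

Fact vdist_positivity (x y : F) : vabs (x - y) = 0 -> x = y.
Proof. by move=> /lf_abs_eq0/eqP; rewrite subr_eq0 => /eqP. Qed.

Fact vdist_triangle (y x z : F) : vabs (x - z) <= vabs (x - y) + vabs (y - z).
Proof.
rewrite -[x - z](subrKA y); apply: le_trans (lf_abs_ultra _ _) _.
by rewrite ge_max lerDl lerDr !lf_abs_ge0.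
Qed.

End AbsoluteValue.

HB.instance Definition _ (R : realType) (F : nonarchimedeanLocalField R) :=
  @isMetric.Build R (lf_sort F) (fun x y => vabs (x - y))
    vdist0 vdist_positivity vabsB vdist_triangle.

Section LocalField.
Context {R : realType} {F : nonarchimedeanLocalField R}.
Implicit Types (x w : F) (psi eta : F -> R[i]).

Definition fq : R := (resq F)%:R.

Definition ringO : set F := [set x | vabs x <= 1].
Definition unitsO : set F := [set x | vabs x = 1].

(* [idealP k] is the fractional ideal p^k. *)
Definition idealP (k : int) : set F := [set x | vabs x <= fq ^ (- k)].

Definition uniformizer w := idealP 1 = [set w * y | y in ringO].

(* 1 + p^n, with the convention 1 + p^0 = o^x *)
Definition unitsP (n : nat) : set F :=
  if n is 0%N then unitsO else [set 1 + y | y in idealP n%:Z].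

(* Continuity is not part of the next two definitions: it follows from
   triviality on o, resp. on some 1 + p^n, which is always assumed. *)
Definition additive_character psi :=
  (forall x, psi x != 0) /\ (forall x y, psi (x + y) = psi x * psi y).

Definition multiplicative_character eta :=
  (forall x, x != 0 -> eta x != 0) /\
  (forall x y, x != 0 -> y != 0 -> eta (x * y) = eta x * eta y).

Definition trivial_on (A : set F) (chi : F -> R[i]) := forall x, A x -> chi x = 1.

Definition conductor_exponent eta (n : nat) :=
  trivial_on (unitsP n) eta /\
  forall m, trivial_on (unitsP m) eta -> (n <= m)%N.

End LocalField.
Arguments fq {R} F.
Arguments ringO {R} F.
Arguments unitsO {R} F.
Arguments idealP {R} F.
Arguments unitsP {R} F.

Notation borel T := (g_sigma_algebraType (@open T)).

Section Complex.
Context {R : realType}.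

(* x ^ s for x > 0 and s complex *)
Definition cpow (x : R) (s : R[i]) : R[i] :=
  Complex (x `^ complex.Re s * cos (complex.Im s * ln x))
          (x `^ complex.Re s * sin (complex.Im s * ln x)).

Definition cintegral d (T : measurableType d) (mu : {measure set T -> \bar R})
    (D : set T) (f : T -> R[i]) : R[i] :=
  Complex (\int[mu]_(x in D) complex.Re (f x))%R
          (\int[mu]_(x in D) complex.Im (f x))%R.

End Complex.

Section GSp4.
Variable F : fieldType.

Definition mx4 (rows : seq (seq F)) : 'M[F]_4 :=
  \matrix_(i, j) nth 0 (nth [::] rows i) j.

Definition Jmx : 'M[F]_4 := mx4
  [:: [::  0;  0; 0; 1];
      [::  0;  0; 1; 0];
      [::  0; -1; 0; 0];
      [:: -1;  0; 0; 0]].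

Definition similitude (g : 'M[F]_4) :=
  exists2 m : F, m != 0 & g^T *m Jmx *m g = m *: Jmx.

Definition is_gsp4 (g : 'M[F]_4) : bool := (g \in unitmx) && `[< similitude g >].

Record gsp4 := Gsp4 { gsp4_mx :> 'M[F]_4; _ : is_gsp4 gsp4_mx }.

HB.instance Definition _ := [isSub for gsp4_mx].
HB.instance Definition _ := [Choice of gsp4 by <:].

Lemma is_gsp4_1 : is_gsp4 1%:M.
Proof.
apply/andP; split; first exact: unitmx1.
by apply/asboolP; exists 1; rewrite ?oner_neq0// trmx1 mul1mx mulmx1 scale1r.
Qed.

Lemma is_gsp4_M g h : is_gsp4 g -> is_gsp4 h -> is_gsp4 (g *m h).
Proof.
move=> /andP[ug /asboolP[m m0 gm]] /andP[uh /asboolP[n n0 hn]].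
apply/andP; split; first by rewrite unitmx_mul ug.
apply/asboolP; exists (m * n); first by rewrite mulf_neq0.
have -> : (g *m h)^T *m Jmx *m (g *m h) = h^T *m (g^T *m Jmx *m g) *m h.
  by rewrite trmx_mul !mulmxA.
by rewrite gm -scalemxAr -scalemxAl hn scalerA.
Qed.

Lemma is_gsp4_V g : is_gsp4 g -> is_gsp4 (invmx g).
Proof.
move=> /andP[ug /asboolP[m m0 gm]]; apply/andP; split; first by rewrite unitmx_inv.
apply/asboolP; exists m^-1; first by rewrite invr_eq0.
have ugT : g^T \in unitmx by rewrite unitmx_tr.
have JE : Jmx = m^-1 *: (g^T *m Jmx *m g) by rewrite gm scalerA mulVf// scale1r.
rewrite {1}JE -scalemxAr -scalemxAl -!mulmxA mulmxV// mulmx1 trmx_inv mulKmx//.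
Qed.

Definition gsp4_one := Gsp4 is_gsp4_1.
Definition gsp4_mul (g h : gsp4) := Gsp4 (is_gsp4_M (valP g) (valP h)).
Definition gsp4_inv (g : gsp4) := Gsp4 (is_gsp4_V (valP g)).

Fact gsp4_mulA : associative gsp4_mul.
Proof. by move=> x y z; apply: val_inj; rewrite /= mulmxA. Qed.
Fact gsp4_mul1 : left_id gsp4_one gsp4_mul.
Proof. by move=> x; apply: val_inj; rewrite /= mul1mx. Qed.
Fact gsp4_1mul : right_id gsp4_one gsp4_mul.
Proof. by move=> x; apply: val_inj; rewrite /= mulmx1. Qed.
Fact gsp4_mulV : left_inverse gsp4_one gsp4_inv gsp4_mul.
Proof. by move=> x; apply: val_inj; rewrite /= mulVmx//; case/andP: (valP x). Qed.
Fact gsp4_Vmul : right_inverse gsp4_one gsp4_inv gsp4_mul.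
Proof. by move=> x; apply: val_inj; rewrite /= mulmxV//; case/andP: (valP x). Qed.

HB.instance Definition _ := isGroup.Build gsp4
  gsp4_mulA gsp4_mul1 gsp4_1mul gsp4_mulV gsp4_Vmul.

Definition gsp4_center : set gsp4 := [set z | forall g, (z * g = g * z)%g].

(* [toG M] is the element of GSp4(F) with matrix [M]; it is the (junk) unit
   element if [M] is not in GSp4(F).  Lemmas [toG_dmat] to [toG_gchi] below
   show that the junk value is never used. *)
Definition toG (M : 'M[F]_4) : gsp4 := insubd (1%g : gsp4) M.

Definition dmat (alpha beta : F) : gsp4 := toG (mx4
  [:: [:: alpha ^+ 2 * beta; 0; 0; 0];
      [:: 0; alpha * beta; 0; 0];
      [:: 0; 0; alpha; 0];
      [:: 0; 0; 0; 1]]).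

Definition umat1 (a : F) : gsp4 := toG (mx4
  [:: [:: 1; a; 0; 0];
      [:: 0; 1; 0; 0];
      [:: 0; 0; 1; - a];
      [:: 0; 0; 0; 1]]).

Definition umat2 (b c e : F) : gsp4 := toG (mx4
  [:: [:: 1; 0; b; c];
      [:: 0; 1; e; b];
      [:: 0; 0; 1; 0];
      [:: 0; 0; 0; 1]]).

Definition umat (a b c e : F) : gsp4 := (umat1 a * umat2 b c e)%g.

Definition zetamat (gamma x : F) : gsp4 := toG (mx4
  [:: [:: gamma; 0; 0; 0];
      [:: 0; gamma; 0; 0];
      [:: 0; x; 1; 0];
      [:: 0; 0; 0; 1]]).

Definition gchi (w t : F) : gsp4 := toG (mx4
  [:: [:: 0; 0; 1; 0];
      [:: 0; 0; 0; -1];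
      [:: - (w / t); 0; 0; 0];
      [:: 0; w / t; 0; 0]]).

Lemma Jmx_unit : Jmx \in unitmx.
Proof.
have : (- Jmx) *m Jmx = 1%:M; last by case/mulmx1_unit.
apply/matrixP => i j; rewrite !mxE !big_ord_recl big_ord0 !mxE.
by case: i => [[|[|[|[|?]]]]]//= ?; case: j => [[|[|[|[|?]]]]]//= ?;
  rewrite ?mxE /=; ring.
Qed.

Lemma toGK (M : 'M[F]_4) (m : F) : m != 0 -> M^T *m Jmx *m M = m *: Jmx ->
  gsp4_mx (toG M) = M.
Proof.
move=> m0 Mm; rewrite [LHS]val_insubd ifT//.
apply/andP; split; last by apply/asboolP; exists m.
have : (m^-1 *: (invmx Jmx *m M^T *m Jmx)) *m M = 1%:M; last by case/mulmx1_unit.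
rewrite -scalemxAl -!mulmxA (mulmxA M^T) Mm -scalemxAr scalerA mulVf// scale1r.
by rewrite mulVmx// Jmx_unit.
Qed.

Local Ltac mx4_entries :=
  apply/matrixP; case=> [[|[|[|[|?]]]]]//= ?; case=> [[|[|[|[|?]]]]]//= ?;
  rewrite !mxE !big_ord_recl big_ord0 !mxE !big_ord_recl !big_ord0 !mxE /=.

Lemma toG_dmat (alpha beta : F) : alpha != 0 -> beta != 0 ->
  gsp4_mx (dmat alpha beta) = mx4
  [:: [:: alpha ^+ 2 * beta; 0; 0; 0];
      [:: 0; alpha * beta; 0; 0];
      [:: 0; 0; alpha; 0];
      [:: 0; 0; 0; 1]].
Proof.
move=> a0 b0; apply: (@toGK _ (alpha ^+ 2 * beta)).
  by rewrite mulf_neq0// expf_neq0.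
by mx4_entries; ring.
Qed.

Lemma toG_umat (a b c e : F) : gsp4_mx (umat a b c e) = mx4
  [:: [:: 1; a; 0; 0];
      [:: 0; 1; 0; 0];
      [:: 0; 0; 1; - a];
      [:: 0; 0; 0; 1]] *m mx4
  [:: [:: 1; 0; b; c];
      [:: 0; 1; e; b];
      [:: 0; 0; 1; 0];
      [:: 0; 0; 0; 1]].
Proof.
by congr (_ *m _); apply: (@toGK _ 1); rewrite ?oner_neq0//; mx4_entries; ring.
Qed.

Lemma toG_zetamat (gamma x : F) : gamma != 0 ->
  gsp4_mx (zetamat gamma x) = mx4
  [:: [:: gamma; 0; 0; 0];
      [:: 0; gamma; 0; 0];
      [:: 0; x; 1; 0];
      [:: 0; 0; 0; 1]].
Proof. by move=> g0; apply: (@toGK _ gamma) => //; mx4_entries; ring. Qed.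

Lemma toG_gchi (w t : F) : w != 0 -> t != 0 ->
  gsp4_mx (gchi w t) = mx4
  [:: [:: 0; 0; 1; 0];
      [:: 0; 0; 0; -1];
      [:: - (w / t); 0; 0; 0];
      [:: 0; w / t; 0; 0]].
Proof.
move=> w0 t0; have : w / t != 0 by rewrite mulf_neq0 ?invr_neq0.
rewrite /gchi; move: (w / t) => v v0; apply: (@toGK _ (- v)); first by rewrite oppr_eq0.
by mx4_entries; ring.
Qed.

Definition zequiv (g h : gsp4) : bool :=
  `[< exists2 z, gsp4_center z & h = (z * g)%g >].

Lemma zequiv_refl : reflexive zequiv.
Proof.
by move=> g; apply/asboolP; exists 1%g => [h|]; rewrite ?mul1g ?mulg1.
Qed.

Lemma zequiv_sym : symmetric zequiv.
Proof.
suff H g h : zequiv g h -> zequiv h g by move=> g h; apply/idP/idP; apply: H.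
move=> /asboolP[z zC ->]; apply/asboolP; exists z^-1%g; last by rewrite mulKg.
by move=> k; apply: (mulgI z); rewrite mulVKg mulgA zC -mulgA mulgV mulg1.
Qed.

Lemma zequiv_trans : transitive zequiv.
Proof.
move=> h g k /asboolP[z zC ->] /asboolP[y yC ->]; apply/asboolP.
exists (y * z)%g; last by rewrite mulgA.
by move=> l; rewrite -mulgA (zC l) mulgA (yC l) mulgA.
Qed.

Canonical zequiv_equiv := EquivRel zequiv zequiv_refl zequiv_sym zequiv_trans.

End GSp4.
Arguments gsp4_center {F}.

Section GSp4Topology.
Context {R : realType} (F : nonarchimedeanLocalField R).

HB.instance Definition _ := Topological.copy (gsp4 F)
  (initial_topology (@gsp4_mx F : gsp4 F -> 'M[F]_4)).
HB.instance Definition _ := isPointed.Build (gsp4 F) (1%g : gsp4 F).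

Definition ZbackslashG : Type :=
  quotient_topology {eq_quot (@zequiv_equiv F)}%qT.

HB.instance Definition _ := Quotient.on ZbackslashG.
HB.instance Definition _ := PointedTopological.on ZbackslashG.

End GSp4Topology.

Section Haar.
Context {R : realType} {F : nonarchimedeanLocalField R}.

Definition additive_haar (mu : {measure set (borel F) -> \bar R}) :=
  (forall (a : F) (A : set (borel F)), measurable A ->
     mu [set (a + x : F) | x in A] = mu A) /\
  mu (ringO F) = 1%E.

(* Haar measure of F^x, seen as a measure on F; it is only constrained on Borel
   sets of F^x, and integrals against it are taken over F^x. *)
Definition multiplicative_haar (nu : {measure set (borel F) -> \bar R}) :=
  (forall (a : F) (A : set (borel F)), a != 0 -> measurable A ->
     A `<=` [set x | x != 0] -> nu [set (a * x : F) | x in A] = nu A) /\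
  nu (unitsO F) = 1%E.

Definition ZG_rtranslate (g : gsp4 F) (x : ZbackslashG F) : ZbackslashG F :=
  \pi_(ZbackslashG F)%qT (repr x * g)%g.

Definition quotient_haar (dg : {measure set (borel (ZbackslashG F)) -> \bar R}) :=
  [/\ forall (g : gsp4 F) (A : set (borel (ZbackslashG F))), measurable A ->
        dg (ZG_rtranslate g @` A) = dg A,
      forall K : set (ZbackslashG F), compact K -> (dg K < +oo)%E &
      forall V : set (ZbackslashG F), open V -> V !=set0 -> (0 < dg V)%E].

End Haar.

Section MinimalVector.
Context {R : realType} {F : nonarchimedeanLocalField R}.
(* [sgn = false] is the sign +, [sgn = true] is the sign - *)
Variables (w : F) (psi : F -> R[i]) (t : F) (sgn : bool).
Implicit Types (g h k z : gsp4 F) (f : gsp4 F -> R[i]).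

Definition psi0 (x : F) : R[i] := psi (w^-1 * x).

(* the entry (i, j), with indices starting from 1 *)
Definition entry g (i j : nat) : F := gsp4_mx g (inord i.-1) (inord j.-1).

Definition Kprime : set (gsp4 F) := [set k | forall i j : 'I_4,
  if (j < i)%N then idealP F 1 (gsp4_mx k i j)
  else if i == j then unitsP F 1 (gsp4_mx k i j)
  else ringO F (gsp4_mx k i j)].

Definition Hgrp : set (gsp4 F) :=
  [set h | exists z k, [/\ gsp4_center z, Kprime k & h = (z * k)%g]].

(* The value does not depend on the decomposition h = zk chosen by [xget]. *)
Definition chiH h : R[i] :=
  let k := xget (1%g : gsp4 F) [set k | Kprime k /\
             exists2 z, gsp4_center z & h = (z * k)%g] in
  psi0 (entry k 1 2 + entry k 2 3 + t * w^-1 * entry k 4 1).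

Definition Hprime : set (gsp4 F) :=
  Hgrp `|` [set (gchi w t * h)%g | h in Hgrp].

Definition chi_pm h : R[i] :=
  if h \in Hgrp then chiH h else (-1) ^+ sgn * chiH ((gchi w t)^-1 * h)%g.

Definition fmin g : R[i] := if g \in Hprime then chi_pm g else 0.

Definition raction g f : gsp4 F -> R[i] := fun x => f (x * g)%g.

(* For f1, f2 in the induced representation the integrand is left invariant
   under Z, on which chi is trivial, so the choice of [repr x] is irrelevant. *)
Definition inner_product (dg : {measure set (borel (ZbackslashG F)) -> \bar R})
    (f1 f2 : gsp4 F -> R[i]) : R[i] :=
  ((fine (dg (\pi_(ZbackslashG F)%qT @` Hprime)))^-1)%:C%C *
  cintegral dg setT (fun x : borel (ZbackslashG F) =>
    f1 (repr (x : ZbackslashG F)) * (f2 (repr (x : ZbackslashG F)))^*%C).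

End MinimalVector.

Section Zeta.
Context {R : realType} {F : nonarchimedeanLocalField R}.
Variable dx : {sigma_finite_measure set (borel F) -> \bar R}.

(* U is parametrized by (a, b, c, e), with du = da db dc de.  Haar measures are
   sigma-finite; the type of [dx] records it so that products are available. *)
Definition whittaker (dg : {measure set (borel (ZbackslashG F)) -> \bar R})
    (w : F) (psi : F -> R[i]) (t : F) (sgn : bool) (c1 c2 : F)
    (phi : gsp4 F -> R[i]) (g : gsp4 F) : R[i] :=
  cintegral (dx \x dx \x dx \x dx)%E setT
    (fun u : borel F * borel F * borel F * borel F =>
      let: (a, b, c, e) := u in
      inner_product w t dg
        (raction (umat (a : F) b c e * g)%g phi)
        (raction (dmat (w^-1 * c1^-1) (w^-1 * c2^-1)) (fmin w psi t sgn))
      * (psi (c1 * a + c2 * e))^-1).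

Definition novodvorsky (dmx : {measure set (borel F) -> \bar R})
    (s : R[i]) (W : gsp4 F -> R[i]) (eta : F -> R[i]) : R[i] :=
  cintegral dmx [set x : F | x != 0] (fun gamma : borel F =>
    cintegral dx setT (fun x : borel F =>
      W (zetamat (gamma : F) x)
      * cpow (vabs (gamma : F)) (s - 3%:R / 2%:R) * eta gamma)).

End Zeta.

(* Main.v *)
(* Write f for the minimal vector, d = d_{alpha,beta} and d' = d_{1/(w c1), 1/(w c2)}.
   For h in H' and k in K' one has f(hk) = f(h) chi(k), and |f(h)| = 1, so the
   matrix coefficient <u g d f, d' f> equals chi(y) if y = d'^-1 u g d lies in K',
   and 0 if y lies outside H'.  The last row of y is (0, 0, 0, 1), so y in H' forces
   y in K'.  In the coordinates of U scaled by d', membership of y in K' splits into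
   independent conditions on alpha, on g = (gamma, x) and on each coordinate of u,
   and there chi(y) = psi(c1 a + c2 e) cancels the Whittaker character: W is q^7
   times an indicator function.  The zeta integral is then the product of q^7,
   the volume of {x : |x beta| < 1}, the volume of 1 + p, and the constant value
   of |gamma|^(s - 3/2) eta(gamma) on the coset (w c2 beta)^-1 (1 + p).

   The normalization by vol(Z\H') is meaningful because Z\H' is open and has
   finite volume; the latter comes from the compactness of K', which rests on
   that of o (completeness and finiteness of the residue field). *)

Require Import Defs.
From mathcomp Require Import all_boot all_order all_algebra.
From mathcomp Require Import all_classical all_reals all_analysis.
From mathcomp Require Import complex.
From mathcomp Require Import ring lra zify.
Set Implicit Arguments.
Unset Strict Implicit.
Unset Printing Implicit Defensive.
Import Order.TTheory GRing.Theory Num.Theory.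
Local Open Scope classical_set_scope.
Local Open Scope ring_scope.

(** * The absolute value *)

Section Valuation.
Context {R : realType} {F : nonarchimedeanLocalField R}.
Implicit Types (x y z : F) (e : R).

Lemma vabs_ge0 x : 0 <= vabs x. Proof. exact: lf_abs_ge0. Qed.

Lemma vabs_eq0 x : (vabs x == 0) = (x == 0).
Proof. by apply/eqP/eqP => /lf_abs_eq0. Qed.

Lemma vabs0 : vabs (0 : F) = 0. Proof. by apply/eqP; rewrite vabs_eq0. Qed.

Lemma vabs_gt0 x : (0 < vabs x) = (x != 0).
Proof. by rewrite lt_def vabs_eq0 vabs_ge0 andbT. Qed.

Lemma vabsM x y : vabs (x * y) = vabs x * vabs y.
Proof. exact: lf_absM. Qed.

Lemma vabs1 : vabs (1 : F) = 1.
Proof.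
have : vabs (1 : F) * vabs (1 : F) = vabs (1 : F) * 1 by rewrite mulr1 -vabsM mulr1.
by apply: mulfI; rewrite vabs_eq0 oner_neq0.
Qed.

Lemma vabsN x : vabs (- x) = vabs x.
Proof. by have := vabsB 0 x; rewrite sub0r subr0. Qed.

Lemma vabsV x : vabs x^-1 = (vabs x)^-1.
Proof.
have [->|x0] := eqVneq x 0; first by rewrite invr0 vabs0 invr0.
have vx0 : vabs x != 0 by rewrite vabs_eq0.
by apply: (mulfI vx0); rewrite -vabsM !mulfV// vabs1.
Qed.

Lemma vabsX x n : vabs (x ^+ n) = vabs x ^+ n.
Proof. by elim: n => [|n IH]; rewrite ?expr0 ?vabs1// !exprS vabsM IH. Qed.

Lemma vabsXz x (n : int) : vabs (x ^ n) = vabs x ^ n.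
Proof. by case: n => n; rewrite ?NegzE -?exprnP -?exprnN ?vabsV vabsX. Qed.

Lemma vabsD x y e : vabs x <= e -> vabs y <= e -> vabs (x + y) <= e.
Proof.
by move=> xe ye; apply: le_trans (lf_abs_ultra _ _) _; rewrite ge_max xe.
Qed.

Lemma vabsD_lt x y e : vabs x < e -> vabs y < e -> vabs (x + y) < e.
Proof.
by move=> xe ye; apply: le_lt_trans (lf_abs_ultra _ _) _; rewrite gt_max xe.
Qed.

Lemma vabsBl x y e : vabs x <= e -> vabs y <= e -> vabs (x - y) <= e.
Proof. by move=> xe ye; apply: vabsD; rewrite ?vabsN. Qed.

Lemma vabsBl_lt x y e : vabs x < e -> vabs y < e -> vabs (x - y) < e.
Proof. by move=> xe ye; apply: vabsD_lt; rewrite ?vabsN. Qed.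

Lemma vdist_le y x z e : vabs (x - y) <= e -> vabs (y - z) <= e -> vabs (x - z) <= e.
Proof. by move=> xy yz; rewrite -(subrKA y); apply: vabsD. Qed.

Lemma vdist_lt y x z e : vabs (x - y) < e -> vabs (y - z) < e -> vabs (x - z) < e.
Proof. by move=> xy yz; rewrite -(subrKA y); apply: vabsD_lt. Qed.

Lemma vabs_sum (I : Type) (r : seq I) (P : pred I) (f : I -> F) e :
  0 <= e -> (forall i, P i -> vabs (f i) <= e) ->
  vabs (\sum_(i <- r | P i) f i) <= e.
Proof.
move=> e0 fe; elim/big_ind: _ => //; first by rewrite vabs0.
by move=> x y; apply: vabsD.
Qed.

Lemma vabs_dominated x y : vabs (x - y) < vabs y -> vabs x = vabs y.
Proof.
move=> xy; apply/eqP; rewrite eq_le; apply/andP; split.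
  by rewrite -[x](subrK y); apply: vabsD => //; apply: ltW.
rewrite leNgt; apply/negP => yx; have : vabs (x - (x - y)) < vabs y by apply: vabsBl_lt.
by rewrite subKr ltxx.
Qed.

(** A generator [v] of p lies in p, so its absolute value 1/q is less than 1; this excludes q = 1.
    The value q = 0 is excluded because the coset of 1 exists. *)
Lemma fq_gt1 : 1 < fq F.
Proof.
have [v vE vP] := uniformizerP F.
have le11 : vabs (1 : F) <= 1 by rewrite vabs1.
have v1 : (lf_abs v < 1).
  suff : [set x : lf_field F | lf_abs x < 1] v by [].
  by rewrite vP; exists 1; rewrite ?mulr1.
have q0 : (0 < resq F)%N.
  rewrite lt0n; apply/negP => /eqP q0; have := resqP F; rewrite q0 II0.
  rewrite card_eq0 => /eqP/image_set0_set0/seteqP[/(_ (1 : lf_field F)) + _].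
  exact.
rewrite /fq ltr1n ltn_neqAle q0 andbT; apply/eqP => q1.
by move: v1; rewrite vE -q1 invr1 ltxx.
Qed.

Lemma fq_gt0 : 0 < fq F. Proof. exact: lt_trans ltr01 fq_gt1. Qed.

(** Discreteness of the valuation: an element of p is [v] times an integer. It lets open conditions
    be read as closed balls and conversely. *)
Lemma vabs_lt1 x : (vabs x < 1) = (vabs x <= (fq F)^-1).
Proof.
have [v vE vP] := uniformizerP F.
apply/idP/idP => [x1|]; last first.
  by move=> /le_lt_trans; apply; rewrite invf_lt1 ?fq_gt1 ?fq_gt0.
have : [set x : lf_field F | lf_abs x < 1] x by [].
rewrite vP => -[y /= y1 <-]; change (vabs ((v : F) * (y : F)) <= (fq F)^-1).
rewrite vabsM; have -> : vabs (v : F) = (fq F)^-1 by [].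
by rewrite ler_piMr// invr_ge0 ltW// fq_gt0.
Qed.

Lemma idealP1E x : idealP F 1 x <-> vabs x < 1.
Proof. by rewrite vabs_lt1. Qed.

Lemma uniformizer_vabs (w : F) : uniformizer w -> vabs w = (fq F)^-1.
Proof.
move=> wP; apply/eqP; rewrite eq_le; apply/andP; split.
  suff : idealP F 1 w by [].
  by rewrite wP; exists 1; rewrite ?mulr1//= /ringO /= vabs1.
have [v vE _] := uniformizerP F.
have : idealP F 1 v by rewrite /idealP/= /vabs vE.
rewrite wP => -[y /= y1 vy].
have <- : vabs (v : F) = (fq F)^-1 by [].
by rewrite -vy vabsM ler_piMr ?vabs_ge0.
Qed.

Lemma uniformizer_neq0 (w : F) : uniformizer w -> w != 0.
Proof.
by move=> /uniformizer_vabs wE; rewrite -vabs_gt0 wE invr_gt0 fq_gt0.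
Qed.

Lemma uniformizer_ex : exists w : F, uniformizer w.
Proof.
have [v vE vP] := uniformizerP F; exists (v : F).
rewrite /uniformizer -[RHS]vP; apply/seteqP.
by split=> x /idealP1E.
Qed.

(** After scaling by a power of a uniformizer the absolute value is at least 1. Take the least k for
    which it is at most q^k: a strict inequality would improve to q^(k-1) by discreteness. *)
Lemma vabs_expz x : x != 0 -> exists n : int, vabs x = fq F ^ n.
Proof.
move=> x0; have [v /uniformizer_vabs vE] := uniformizer_ex.
have q1 := fq_gt1; have q0 := fq_gt0.
have archi (r : R) : exists k, r <= fq F ^+ k.
  exists (Num.bound `|r|); apply: (le_trans (ler_norm r)).
  apply: (le_trans (ltW (archi_boundP (normr_ge0 r)))).
  by rewrite /fq -natrX ler_nat ltnW// ltn_expl// -(ltr_nat R).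
have [M MP] := archi (vabs x)^-1.
pose y := x * v ^ (- M%:Z).
have yE : vabs y = vabs x * fq F ^+ M by rewrite vabsM vabsXz vE exprz_inv opprK.
have y1 : 1 <= vabs y.
  rewrite yE -(@mulfV _ (vabs x)) ?vabs_eq0//.
  by rewrite ler_wpM2l ?vabs_ge0.
case: (ex_minnP (archi (vabs y))) => k yk kmin.
have : vabs y = fq F ^+ k.
  apply/eqP; rewrite eq_le yk; case: k yk kmin => [|k] yk kmin //.
  rewrite leNgt; apply/negP => lt_yk.
  have : vabs (y * v ^+ k.+1) < 1.
    by rewrite vabsM vabsX vE exprVn ltr_pdivrMr ?exprn_gt0// mul1r.
  rewrite vabs_lt1 vabsM vabsX vE exprVn ler_pdivrMr ?exprn_gt0//.
  by rewrite exprS mulKf ?gt_eqF// => /kmin; rewrite ltnn.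
rewrite yE => xE; exists (k%:Z - M%:Z); rewrite expfzDr ?gt_eqF//.
rewrite -[fq F ^ k]/(fq F ^+ k) -xE -exprnN mulfK//.
by rewrite expf_neq0// gt_eqF.
Qed.

End Valuation.

(** * Residues and Haar volumes *)

Section Residues.
Context {R : realType} {F : nonarchimedeanLocalField R}.
Implicit Types (x y z : F) (e : R).

(** The bijection behind [resqP] numbers the cosets; picking one element in each gives the form
    needed to cut o and its units into finitely many pieces. *)
Lemma residue_representatives : exists rep : nat -> F,
  [/\ forall i, (i < resq F)%N -> vabs (rep i) <= 1,
      forall x, vabs x <= 1 -> exists2 i, (i < resq F)%N & vabs (x - rep i) < 1 &
      forall i j, (i < resq F)%N -> (j < resq F)%N ->
        vabs (rep i - rep j) < 1 -> i = j].
Proof.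
have /card_set_bijP[f [fI finj fsurj]] := resqP F.
pose coset x : set F := [set y : F | vabs (y - x) < 1].
have coset_eq x y : vabs (x - y) < 1 -> coset x = coset y.
  move=> xy; apply/seteqP; split=> z /= zc; first exact: vdist_lt zc xy.
  by apply: vdist_lt zc _; rewrite vabsB.
have : forall i, exists x, (i < resq F)%N -> vabs x <= 1 /\ f (coset x) = i.
  move=> i; have [ilt|ige] := ltnP i (resq F); last by exists 0.
  by have [_ [x x1 <-] <-] := fsurj i ilt; exists x.
move=> /boolp.choice[rep repP]; exists rep; split=> [i /repP[]//|x x1|i j ilt jlt ij].
  have fx : (f (coset x) < resq F)%N by apply: fI; exists x.
  exists (f (coset x)) => //; have [r1 fE] := repP _ fx.
  have rE : coset (rep (f (coset x))) = coset x.
    by apply: finj fE; apply/mem_set; [exists (rep (f (coset x)))|exists x].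
  have : coset (rep (f (coset x))) x by rewrite rE /coset /= vdist0.
  exact.
have [ri <-] := repP i ilt; have [rj <-] := repP j jlt.
by rewrite (coset_eq _ _ ij).
Qed.

End Residues.

(** * Open sets of the field *)

Section Topology.
Context {R : realType} {F : nonarchimedeanLocalField R}.
Implicit Types (x y z : F) (e : R).

Lemma nbhs_vabs x (A : set F) :
  nbhs x A <-> exists2 e, 0 < e & [set y : F | vabs (x - y) < e] `<=` A.
Proof. by split=> [/nbhs_ballP|?]; last apply/nbhs_ballP. Qed.

Lemma open_vabs (A : set F) :
  (forall x, A x -> exists2 e, 0 < e & [set y : F | vabs (x - y) < e] `<=` A) ->
  open A.
Proof. by move=> AP; rewrite openE => x /AP /nbhs_vabs. Qed.

Lemma open_closed_ball (x : F) e : 0 < e -> open [set y : F | vabs (y - x) <= e].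
Proof.
move=> e0; apply: open_vabs => y yx; exists e => // z yz /=.
by apply: (@vdist_le _ _ y) => //; rewrite vabsB; apply: ltW.
Qed.

Lemma open_neq0 : open [set x : F | x != 0].
Proof.
apply: open_vabs => x x0; exists (vabs x); first by rewrite vabs_gt0.
move=> z xz /=; apply: contraTneq xz => ->.
by rewrite subr0 ltxx.
Qed.

Lemma borel_open (T : ptopologicalType) (A : set T) :
  open A -> measurable (A : set (borel T)).
Proof. exact: sub_sigma_algebra. Qed.

Lemma measure_equal_parts (mu : {measure set (borel F) -> \bar R})
    (n : nat) (A : nat -> set F) (m : \bar R) :
  (forall i, (i < n)%N -> open (A i)) ->
  (forall i j, (i < n)%N -> (j < n)%N -> A i `&` A j !=set0 -> i = j) ->
  (forall i, (i < n)%N -> mu (A i) = m) ->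
  mu (\bigcup_(i < n) A i) = (n%:R%:E * m)%E.
Proof.
move=> Ao Atriv Am; rewrite measure_fin_bigcup //; last by move=> i /Ao /borel_open.
rewrite -fsbig_ord (eq_bigr (fun=> m)) => [|i _]; last exact: Am.
by rewrite mule_natl big_const_ord iter_addr_0.
Qed.

(** * Additive volume of fractional ideals *)

Section Additive.
Variables (mu : {measure set (borel F) -> \bar R}).
Hypothesis mu_haar : additive_haar mu.

(** The ideal p^n is a disjoint union of q translates of p^(n+1), so each step divides the volume by
    q; the induction runs in both directions from the volume of o. *)
Lemma haar_idealP (k : int) : mu (idealP F k) = (fq F ^ (- k))%:E.
Proof.
have q0 := @fq_gt0 R F; have [v /uniformizer_vabs vE] := @uniformizer_ex R F.
have [rep [rep1 repx rep_inj]] := @residue_representatives R F.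
have qz0 (n : int) : 0 < fq F ^ n by rewrite exprz_gt0.
have step n : mu (idealP F n) = ((fq F)%:E * mu (idealP F (n + 1)))%E.
  pose A i := [set v ^ n * rep i + y | y in idealP F (n + 1)].
  have AE i : A i = [set y : F | vabs (y - v ^ n * rep i) <= fq F ^ (- (n + 1))].
    apply/seteqP; split=> y /=; first by move=> [z zP <-]; rewrite addrC addKr.
    by move=> yP; exists (y - v ^ n * rep i) => //; rewrite subrKC.
  (* Scaling by [v ^ n] turns congruence modulo p into congruence modulo p^(n+1). *)
  have ltE x : (vabs (v ^ n * x) <= fq F ^ (- (n + 1))) = (vabs x < 1).
    rewrite vabsM vabsXz vE vabs_lt1 exprz_inv opprD expfzDr ?gt_eqF//.
    by rewrite ler_pM2l.
  have -> : idealP F n = \bigcup_(i < resq F) A i.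
    apply/seteqP; split=> y.
      move=> yn; have : vabs (v ^ (- n) * y) <= 1.
        by rewrite vabsM vabsXz vE exprz_inv opprK -ler_pdivlMl// mulr1 invr_expz.
      move=> /repx[i iq yi]; exists i => //; rewrite AE /=.
      rewrite -[y](@mulVKf _ (v ^ n)) -?mulrBr ?invr_expz ?ltE//.
      by rewrite -vabs_gt0 vabsXz vE exprz_inv.
    move=> [i /= iq [z zP <-]]; apply: vabsD.
      rewrite vabsM vabsXz vE exprz_inv ler_piMr//; [exact: ltW | exact: rep1].
    by apply: le_trans zP _; apply: (ler_weXz2l (ltW fq_gt1)); rewrite lerN2 lerDl.
  rewrite (@measure_equal_parts _ _ _ (mu (idealP F (n + 1)))) //.
  - by move=> i _; rewrite AE; apply: open_closed_ball.
  - move=> i j iq jq [y []]; rewrite !AE /= => yi yj; apply: rep_inj => //.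
    rewrite -ltE mulrBr.
    by apply: (@vdist_le _ _ y) => //; rewrite vabsB.
  - move=> i _; apply: mu_haar.1; apply: borel_open.
    by have := @open_closed_ball 0 _ (qz0 (- (n + 1))); under eq_set do rewrite subr0.
have stepV n : mu (idealP F (n + 1)) = ((fq F)^-1%:E * mu (idealP F n))%E.
  by rewrite (step n) muleA -EFinM mulVf ?mul1e ?gt_eqF.
case: k => n.
  elim: n => [|n IH]; first exact: mu_haar.2.
  by rewrite -addn1 PoszD stepV IH -EFinM opprD expfzDr ?gt_eqF// mulrC.
rewrite NegzE opprK; elim: n => [|n IH].
  by rewrite (step (-1)) addNr -[idealP F 0]/(ringO F) mu_haar.2 mule1.
rewrite (step (- n.+2%:Z)); have -> : (- n.+2%:Z + 1 = - n.+1%:Z) by lia.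
by rewrite IH -EFinM; congr (_%:E); exact: esym (exprS _ _).
Qed.

Lemma haar_ball (b : F) : b != 0 ->
  mu [set x | vabs x <= vabs b] = (vabs b)%:E.
Proof.
move=> /vabs_expz[n bE]; rewrite bE.
by have := haar_idealP (- n); rewrite /idealP opprK.
Qed.

End Additive.

(** * Multiplicative volume of cosets of 1 + p *)

Section Multiplicative.
Variables (nu : {measure set (borel F) -> \bar R}).
Hypothesis nu_haar : multiplicative_haar nu.

Lemma unitsP1E x : unitsP F 1 x <-> vabs (x - 1) < 1.
Proof.
split=> [[y /idealP1E y1 <-]|x1]; first by rewrite addrC addKr.
by exists (x - 1); rewrite ?subrKC//; apply/idealP1E.
Qed.

Lemma unitsP1_vabs x : unitsP F 1 x -> vabs x = 1.
Proof. by move=> /unitsP1E x1; rewrite -(@vabs1 R F); apply: vabs_dominated; rewrite vabs1. Qed.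

Lemma open_unit_coset (a : F) : a != 0 -> open [set a * x | x in unitsP F 1].
Proof.
move=> a0; have va : 0 < vabs a by rewrite vabs_gt0.
apply: open_vabs => _ [x /unitsP1E x1 <-]; exists (vabs a) => // y /= xy.
exists (a^-1 * y); last by rewrite mulVKf.
apply/unitsP1E; have -> : a^-1 * y - 1 = (x - 1) - a^-1 * (a * x - y) by field.
by apply: vabsBl_lt => //; rewrite vabsM vabsV mulrC ltr_pdivrMr// mul1r.
Qed.

(** The unit group has volume 1 and is the disjoint union of q - 1 cosets of 1 + p, one for each
    nonzero residue class. *)
Lemma haar_unit_coset (a : F) : a != 0 ->
  nu [set a * x | x in unitsP F 1] = ((fq F - 1)^-1)%:E.
Proof.
have unitsP_neq0 : unitsP F 1 `<=` [set x | x != 0].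
  by move=> x /unitsP1_vabs x1 /=; rewrite -vabs_gt0 x1.
have units_meas : measurable (unitsP F 1 : set (borel F)).
  apply: borel_open; have := @open_unit_coset 1 (oner_neq0 F).
  by under [X in open X]eq_imagel do rewrite mul1r; rewrite image_id.
have cosetE b : b != 0 -> nu [set b * x | x in unitsP F 1] = nu (unitsP F 1).
  by move=> b0; apply: nu_haar.1.
move=> a0; rewrite cosetE//.
have [rep [rep1 repx rep_inj]] := @residue_representatives R F.
(* [i0] is the index of the zero class. Below, [bump i0] skips it and so enumerates the q - 1
   classes of units. *)
have [|i0 i0q] := repx 0; first by rewrite vabs0.
rewrite sub0r vabsN => rep_i0.
have rep_unit i : (i < resq F)%N -> i != i0 -> vabs (rep i) = 1.
  move=> iq ii0; apply/eqP; rewrite eq_le rep1//= leNgt; apply/negP => ri.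
  by move/eqP: ii0; apply; apply: rep_inj => //; apply: vabsBl_lt.
have bump_lt i : (i < (resq F).-1)%N -> (bump i0 i < resq F)%N.
  by move: i0q; rewrite /bump; lia.
have rep_bump i : (i < (resq F).-1)%N -> vabs (rep (bump i0 i)) = 1.
  by move=> iq; rewrite rep_unit ?bump_lt// eq_sym neq_bump.
have rep_neq0 i : (i < (resq F).-1)%N -> rep (bump i0 i) != 0.
  by move=> /rep_bump r1; rewrite -vabs_gt0 r1.
have : nu (unitsO F) = ((fq F - 1)%:E * nu (unitsP F 1))%E.
  have -> : unitsO F = \bigcup_(i < (resq F).-1)
      [set rep (bump i0 i) * x | x in unitsP F 1].
    apply/seteqP; split=> y.
      move=> y1; have [|i iq yi] := repx y; first by rewrite y1.
      have ii0 : i != i0.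
        apply: contraTneq (isT : true) => ii0; move: y1 yi; rewrite ii0 => y1 yi.
        have : vabs (y - rep i0 + rep i0) < 1 by apply: vabsD_lt.
        by rewrite subrK y1 ltxx.
      have ri := rep_unit i iq ii0.
      have ri0 : rep i != 0 by rewrite -vabs_gt0 ri.
      exists (unbump i0 i); first by move: ii0 iq i0q; rewrite /unbump /=; lia.
      rewrite unbumpK ?inE//; exists ((rep i)^-1 * y); last by rewrite mulVKf.
      apply/unitsP1E; have -> : (rep i)^-1 * y - 1 = (rep i)^-1 * (y - rep i) by field.
      by rewrite vabsM vabsV ri invr1 mul1r.
    move=> [i iq [x /unitsP1_vabs x1 <-]].
    by rewrite /unitsO/= vabsM x1 rep_bump ?mulr1.
  rewrite (@measure_equal_parts _ _ _ (nu (unitsP F 1))).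
  - rewrite /fq; congr (_%:E * _)%E; rewrite -subn1 natrB//.
    exact: leq_ltn_trans i0q.
  - by move=> i iq; apply: open_unit_coset; apply: rep_neq0.
  - move=> i j iq jq [_ [[x /unitsP1E x1 <-] [y /unitsP1E y1 yE]]].
    apply: (can_inj (bumpK i0)); apply: rep_inj; rewrite ?bump_lt//.
    set r := rep (bump i0 i) in yE *; set r' := rep (bump i0 j) in yE *.
    have -> : r - r' = (r' * (y - 1)) - r * (x - 1) by rewrite !mulrBr yE; ring.
    by apply: vabsBl_lt; rewrite vabsM rep_bump// mul1r.
  - by move=> i iq; apply: cosetE; apply: rep_neq0.
have q1 : 0 < fq F - 1 by rewrite subr_gt0 fq_gt1.
rewrite nu_haar.2 => nuE; apply/esym/eqP.
rewrite -[X in X == _]mule1 eqe_pdivrMl; last by rewrite gt_eqF.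
exact/eqP.
Qed.

End Multiplicative.

End Topology.

(** * Compactness of the ring of integers *)

Section Compactness.
Context {R : realType} {F : nonarchimedeanLocalField R}.
Implicit Types (x y z : F) (e : R).

Lemma expr_lt_eps e : 0 < e -> exists n : nat, (fq F) ^- n < e.
Proof.
move=> e0; exists (Num.bound e^-1); have q1 := @fq_gt1 R F.
rewrite invf_plt ?posrE ?exprn_gt0 ?fq_gt0//.
have e1 : 0 <= e^-1 by rewrite invr_ge0 ltW.
apply: (lt_trans (archi_boundP e1)).
by rewrite /fq -natrX ltr_nat ltn_expl// -(ltr_nat R).
Qed.

(** Total boundedness of o: each ball of radius q^-n is refined into q balls of radius q^-(n+1), one
    for each residue class. *)
Lemma ringO_finite_net (n : nat) : exists s : seq F,
  forall x, ringO F x -> exists2 c, c \in s & vabs (x - c) <= fq F ^- n.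
Proof.
have [v /uniformizer_vabs vE] := @uniformizer_ex R F.
have [rep [rep1 repx _]] := @residue_representatives R F.
have v0 : v != 0 by rewrite -vabs_gt0 vE invr_gt0 fq_gt0.
elim: n => [|n [s sP]].
  by exists [:: 0] => x x1; exists 0; rewrite ?inE// subr0 expr0 invr1.
exists [seq c + v ^+ n * rep i | c <- s, i <- iota 0 (resq F)] => x /sP[c cs xc].
have /repx[i iq xi] : vabs ((x - c) / v ^+ n) <= 1.
  rewrite vabsM vabsV vabsX vE exprVn invrK -ler_pdivlMr ?exprn_gt0 ?fq_gt0//.
  by rewrite div1r.
exists (c + v ^+ n * rep i).
  by apply/allpairsP; exists (c, i); split; rewrite ?mem_iota.
have -> : x - (c + v ^+ n * rep i) = v ^+ n * ((x - c) / v ^+ n - rep i).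
  by rewrite mulrBr [_ * (_ / _)]mulrC divfK ?expf_neq0// opprD addrA.
rewrite vabsM vabsX vE exprVn exprSr invfM.
by rewrite ler_pM2l ?invr_gt0 ?exprn_gt0 ?fq_gt0// -vabs_lt1.
Qed.

(** Induction on [s]: an ultrafilter contains the first set or its complement, and in the second
    case the remaining sets suffice. *)
Lemma ultrafilter_seq (T : Type) (I : eqType) (U : set_system T)
    (UU : UltraFilter U) (s : seq I) (A : I -> set T) :
  U [set x | exists2 c, c \in s & A c x] -> exists2 c, c \in s & U (A c).
Proof.
elim: s => [|c s IH] Us.
  have [x [c]//] := @filter_ex _ U _ _ Us.
have [UA|UA] := in_ultra_setVsetC (A c) UU.
  by exists c; rewrite ?mem_head.
have [|d ds Ud] := IH; last by exists d => //; rewrite inE ds orbT.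
apply: filterS (filterI Us UA) => x [[d]]; rewrite inE.
by move=> /orP[/eqP->//|ds Adx _]; exists d.
Qed.

(** The finite nets provide, for every n, a ball of radius q^-n whose preimage is in [U]. Any two of
    these preimages meet, so the centres form a Cauchy sequence, and completeness gives the
    limit. *)
Lemma ultrafilter_ringO_limit (T : Type) (U : set_system T)
    (UU : UltraFilter U) (f : T -> F) :
  U [set x | ringO F (f x)] ->
  exists l, forall e, 0 < e -> U [set x | vabs (f x - l) < e].
Proof.
move=> UO; have q0 := @fq_gt0 R F.
have /boolp.choice[c cP] : forall n : nat, exists c, U [set x | vabs (f x - c) <= fq F ^- n].
  move=> n; have [s sP] := ringO_finite_net n.
  have [|c _] := @ultrafilter_seq T F U UU s (fun c => [set x | vabs (f x - c) <= fq F ^- n]).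
    by apply: filterS UO => x /sP[c cs xc]; exists c.
  by exists c.
have small e n m : fq F ^- n < e -> (n <= m)%N -> fq F ^- m < e.
  move=> + nm; apply: le_lt_trans; rewrite lef_pV2 ?posrE ?exprn_gt0//.
  by rewrite ler_weXn2l// ltW// fq_gt1.
have [|l lP] := @lf_complete R F c.
  move=> e /expr_lt_eps[n ne]; exists n => i j ni nj.
  have [x [/= xi xj]] := filter_ex (filterI (cP i) (cP j)).
  apply: (@vdist_lt _ _ (f x)); last exact: le_lt_trans xj (small _ _ _ ne nj).
  by rewrite vabsB; apply: le_lt_trans xi (small _ _ _ ne ni).
exists l => e e0; have [n ne] := expr_lt_eps e0; have [m mP] := lP _ e0.
apply: filterS (cP (maxn n m)) => x /= xc; apply: (@vdist_lt _ _ (c (maxn n m))).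
  by apply: le_lt_trans xc (small _ _ _ ne (leq_maxl _ _)).
exact: mP (leq_maxr _ _).
Qed.

End Compactness.

(** * The group GSp(4) *)

Local Notation o0 := (@Ordinal 4 0 isT).
Local Notation o1 := (@Ordinal 4 1 isT).
Local Notation o2 := (@Ordinal 4 2 isT).
Local Notation o3 := (@Ordinal 4 3 isT).

Lemma ord4_ind (P : 'I_4 -> Prop) : P o0 -> P o1 -> P o2 -> P o3 -> forall i, P i.
Proof.
move=> P0 P1 P2 P3; case=> [[|[|[|[|?]]]]]//= p.
- by rewrite (_ : Ordinal p = o0)//; apply: val_inj.
- by rewrite (_ : Ordinal p = o1)//; apply: val_inj.
- by rewrite (_ : Ordinal p = o2)//; apply: val_inj.
- by rewrite (_ : Ordinal p = o3)//; apply: val_inj.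
Qed.

Lemma sum_ord4 (V : nmodType) (f : 'I_4 -> V) :
  \sum_(i < 4) f i = f o0 + f o1 + f o2 + f o3.
Proof.
rewrite !big_ord_recr big_ord0 /= add0r.
by congr (f _ + f _ + f _ + f _); apply: val_inj.
Qed.

Section GSp4Algebra.
Variable K : fieldType.
Implicit Types (g h k z : gsp4 K) (M : 'M[K]_4).

Lemma gsp4M g h : gsp4_mx (g * h)%g = gsp4_mx g *m gsp4_mx h.
Proof. by []. Qed.

Lemma gsp4_unit g : gsp4_mx g \in unitmx.
Proof. by case/andP: (valP g). Qed.

Lemma gsp4_similitude g : similitude (gsp4_mx g).
Proof. by case/andP: (valP g) => _ /asboolP. Qed.

Lemma gsp4_scalar_central z (c : K) : gsp4_mx z = c%:M -> gsp4_center z.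
Proof. by move=> zE g; apply: val_inj; rewrite /= zE scalar_mxC. Qed.

Lemma mx4E (rows : seq (seq K)) i j : mx4 rows i j = nth 0 (nth [::] rows i) j.
Proof. by rewrite mxE. Qed.

Lemma JmxM M i j : (Jmx K *m M) i j = (if (i < 2)%N then 1 else -1) * M (rev_ord i) j.
Proof.
rewrite mxE sum_ord4 !mx4E.
elim/ord4_ind: i => /=; rewrite ?mul0r ?mul1r ?addr0 ?add0r; congr (_ * M _ _) || congr (M _ _);
  exact: val_inj.
Qed.

Lemma MJmx M i j : (M *m Jmx K) i j = - (if (j < 2)%N then 1 else -1) * M i (rev_ord j).
Proof.
rewrite mxE sum_ord4 !mx4E.
elim/ord4_ind: j => /=; rewrite ?mulr0 ?mulr1 ?addr0 ?add0r ?opprK ?mulN1r ?mulrN1 ?mul1r;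
  congr (- (M _ _)) || congr (M _ _); exact: val_inj.
Qed.

Lemma JJ : Jmx K *m Jmx K = - 1%:M.
Proof.
apply/matrixP => i j; rewrite JmxM !mxE.
by elim/ord4_ind: i; elim/ord4_ind: j => /=; ring.
Qed.

(** Commuting with a diagonal element whose entries are distinct kills the entries off the diagonal;
    commuting with one unipotent element then equates the diagonal entries. *)
Lemma gsp4_central_scalar z : [pchar K] =i pred0 -> gsp4_center z ->
  exists2 c : K, c != 0 & gsp4_mx z = c%:M.
Proof.
move=> /pcharf0P char0 zC; set M := gsp4_mx z.
have two0 : 2%:R != 0 :> K by rewrite char0.
(* [dmat 2 2] is diag(8, 4, 2, 1); its entries are distinct powers of 2 because the characteristic
   is zero. *)
have D i j : M i j * 2%:R ^+ rev_ord j = 2%:R ^+ rev_ord i * M i j.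
  have /(congr1 (@gsp4_mx K)) := zC (dmat 2%:R 2%:R).
  rewrite !gsp4M toG_dmat// => /matrixP/(_ i j); rewrite !mxE !sum_ord4 !mx4E.
  elim/ord4_ind: i; elim/ord4_ind: j => /= E;
    apply: (etrans _ (etrans E _)); rewrite -/M /rev_ord /=; ring.
have off i j : i != j -> M i j = 0.
  move=> ij; apply/eqP; have /eqP : (2%:R ^+ rev_ord j - 2%:R ^+ rev_ord i) * M i j = 0.
    by rewrite mulrBl -D mulrC subrr.
  rewrite mulf_eq0 subr_eq0 -!natrX => /orP[|//].
  have natrI m n : (m%:R == n%:R :> K) = (m == n).
    wlog mn : m n / (m <= n)%N => [H|].
      by case/orP: (leq_total m n) => /H// E; rewrite eq_sym E eq_sym.
    by rewrite -[n in LHS](subnK mn) natrD -subr_eq0 opprD addrCA subrr addr0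
      oppr_eq0 char0; apply/eqP/eqP; lia.
  rewrite natrI eqn_exp2l// => /eqP/= E; move: ij; rewrite -val_eqE /=.
  by move: E (ltn_ord i) (ltn_ord j); lia.
pose d i := M i i.
have ME i j : M i j = if i == j :> nat then d i else 0.
  by case: eqP => [/val_inj<-|/eqP/off].
(* Just above its diagonal, [umat 1 0 0 1] has the entries 1, 1, -1, all nonzero, so that
   neighbouring diagonal entries of [M] are compared. *)
have [d23 d12 d01] : [/\ d o2 = d o3, d o1 = d o2 & d o0 = d o1].
  have /(congr1 (@gsp4_mx K)) := zC (umat 1 0 0 1).
  rewrite (gsp4M z) (gsp4M _ z) toG_umat -/M => /matrixP E.
  by split; [have := E o2 o3 | have := E o1 o2 | have := E o0 o1];
    rewrite !(mxE, sum_ord4) !ME /= => /eqP; rewrite -subr_eq0 => /eqP H;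
    apply: subr0_eq; [rewrite -[RHS]oppr0|..]; rewrite -H; ring.
have dE i : d i = d o0 by elim/ord4_ind: i; rewrite -?d23 -?d12 -?d01.
exists (d o0).
  have := gsp4_unit z; rewrite -/M; apply: contraTneq => d0.
  have -> : M = 0 by apply/matrixP => i j; rewrite mxE ME dE d0 if_same.
  by rewrite unitmxE det0 unitr0.
apply/matrixP => i j; rewrite ME mxE dE -val_eqE /=.
by case: (_ == _).
Qed.

End GSp4Algebra.

(** * The pro-unipotent Iwahori subgroup *)

Section Iwahori.
Context {R : realType} {F : nonarchimedeanLocalField R}.
Implicit Types (x y : F) (M N : 'M[F]_4) (g h k z : gsp4 F).

Lemma entryE g (i j : 'I_4) : entry g i.+1 j.+1 = gsp4_mx g i j.
Proof. by rewrite /entry /= !inord_val. Qed.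

(** The entry conditions of [Kprime] for a bare matrix, usable before membership in GSp(4) is known
    (for limits and sums). Diagonal and strictly lower entries share the second clause. *)
Definition iwahori M := forall i j : 'I_4, vabs (M i j) <= 1 /\
  ((j <= i)%N -> vabs (M i j - (i == j)%:R) < 1).

Lemma vabsM_le1 x y : vabs x <= 1 -> vabs y <= 1 -> vabs (x * y) <= 1.
Proof. by move=> x1 y1; rewrite vabsM mulr_ile1 ?vabs_ge0. Qed.

Lemma vabsM_lt1l x y : vabs x < 1 -> vabs y <= 1 -> vabs (x * y) < 1.
Proof. by move=> x1 y1; rewrite vabsM; apply: le_lt_trans x1; rewrite ler_piMr ?vabs_ge0. Qed.

Lemma vabsM_lt1r x y : vabs x <= 1 -> vabs y < 1 -> vabs (x * y) < 1.
Proof. by move=> x1 y1; rewrite mulrC vabsM_lt1l. Qed.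

Lemma vabs_sum_lt1 (I : finType) (f : I -> F) :
  (forall i, vabs (f i) < 1) -> vabs (\sum_i f i) < 1.
Proof.
move=> f1; rewrite vabs_lt1; apply: vabs_sum => [|i _]; last by rewrite -vabs_lt1.
by rewrite invr_ge0 ltW// fq_gt0.
Qed.

Lemma vabs_nat_bool (b : bool) : vabs (b%:R : F) <= 1.
Proof. by case: b; rewrite ?vabs1// vabs0 ler01. Qed.

Lemma KprimeP k : Kprime k <-> iwahori (gsp4_mx k).
Proof.
split=> kK i j; have := kK i j.
  case: ltngtP => [ji|ij|/val_inj ->].
  - move=> /idealP1E kij; split; first exact: ltW.
    by rewrite -val_eqE gtn_eqF// subr0.
  - by rewrite -val_eqE ltn_eqF.
  - by rewrite eqxx => kjj; split; [rewrite (unitsP1_vabs kjj) | move: kjj => /unitsP1E].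
case: ltngtP => [ji|ij|/val_inj ->] [k1 k2].
- by apply/idealP1E; have := k2 isT; rewrite -val_eqE gtn_eqF// subr0.
- by rewrite -val_eqE ltn_eqF.
- by rewrite eqxx; apply/unitsP1E; have := k2 isT; rewrite eqxx.
Qed.

(** Write M N - 1 = (M - 1) N + (N - 1). At a position with j <= i, a term with k <= i has its first
    factor in p; a term with k > i has j < k, hence its second factor in p. *)
Lemma iwahoriM M N : iwahori M -> iwahori N -> iwahori (M *m N).
Proof.
move=> MI NI i j; rewrite mxE; split=> [|ji].
  apply: vabs_sum => // k _.
  by apply: vabsM_le1; [case: (MI i k)|case: (NI k j)].
have -> : \sum_k M i k * N k j - (i == j)%:R =
    \sum_k ((M i k - (i == k)%:R) * N k j) + (N i j - (i == j)%:R).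
  under [in RHS]eq_bigr do rewrite mulrBl.
  have E : \sum_k (i == k)%:R * N k j = N i j.
    rewrite (bigD1 i) //= eqxx mul1r big1 ?addr0// => k ki.
    by rewrite eq_sym (negPf ki) mul0r.
  by rewrite sumrB E; ring.
apply: vabsD_lt; last by case: (NI i j) => _; apply.
apply: vabs_sum_lt1 => k; have [ki|ik] := leqP k i.
  by apply: vabsM_lt1l; [case: (MI i k) => _; apply|case: (NI k j)].
apply: vabsM_lt1r.
  by apply: vabsBl; [case: (MI i k) | exact: vabs_nat_bool].
have jk : (j < k)%N := leq_ltn_trans ji ik.
case: (NI k j) => _ /(_ (ltnW jk)).
by rewrite -val_eqE gtn_eqF// subr0.
Qed.

Lemma iwahori_diag M i : iwahori M -> vabs (M i i - 1) < 1.
Proof. by move=> /(_ i i)[_ /(_ (leqnn _))]; rewrite eqxx. Qed.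

Lemma iwahori_lower M (i j : 'I_4) : iwahori M -> (j < i)%N -> vabs (M i j) < 1.
Proof.
move=> /(_ i j)[_ Mij] ji; have := Mij (ltnW ji).
by rewrite -val_eqE gtn_eqF// subr0.
Qed.

Lemma iwahori_le1 M i j : iwahori M -> vabs (M i j) <= 1.
Proof. by move=> /(_ i j)[]. Qed.

Lemma scalar_iwahori (c : F) : vabs (c - 1) < 1 -> iwahori c%:M.
Proof.
move=> c1 i j; have cu : vabs c = 1 by apply: unitsP1_vabs; apply/unitsP1E.
rewrite mxE; case: eqVneq => [->|ij].
  by rewrite mulr1n cu.
by rewrite mulr0n subr0 vabs0 ler01 ltr01.
Qed.

Lemma vabs_invrB1 (c : F) : vabs (c - 1) < 1 -> vabs (c^-1 - 1) < 1.
Proof.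
move=> c1; have cu : vabs c = 1 by apply: unitsP1_vabs; apply/unitsP1E.
have c0 : c != 0 by rewrite -vabs_gt0 cu.
have -> : c^-1 - 1 = - (c^-1 * (c - 1)) by rewrite mulrBr mulVf// mulr1 opprB.
by rewrite vabsN vabsM vabsV cu invr1 mul1r.
Qed.

(** The upper right entry of the similitude relation expresses [m] as the product of two diagonal
    entries, up to terms that contain a strictly lower entry of [M]. *)
Lemma iwahori_similitude M (m : F) : iwahori M ->
  M^T *m Jmx F *m M = m *: Jmx F -> vabs (m - 1) < 1.
Proof.
move=> MI /matrixP/(_ o0 o3); rewrite -mulmxA !mxE sum_ord4 !JmxM !mxE /= mulr1 => <-.
rewrite (_ : rev_ord o0 = o3); last exact: val_inj.
rewrite (_ : rev_ord o1 = o2); last exact: val_inj.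
rewrite (_ : rev_ord o2 = o1); last exact: val_inj.
rewrite (_ : rev_ord o3 = o0); last exact: val_inj.
have -> : M o0 o0 * (1 * M o3 o3) + M o1 o0 * (1 * M o2 o3) +
    M o2 o0 * (-1 * M o1 o3) + M o3 o0 * (-1 * M o0 o3) - 1 =
  ((M o0 o0 - 1) * M o3 o3 + (M o3 o3 - 1)) + M o1 o0 * M o2 o3
  - M o2 o0 * M o1 o3 - M o3 o0 * M o0 o3 by ring.
apply: vabsBl_lt; first apply: vabsBl_lt; first apply: vabsD_lt; first apply: vabsD_lt.
- by apply: vabsM_lt1l; [exact: iwahori_diag|exact: iwahori_le1].
- exact: iwahori_diag.
- by apply: vabsM_lt1l; [exact: iwahori_lower|exact: iwahori_le1].
- by apply: vabsM_lt1l; [exact: iwahori_lower|exact: iwahori_le1].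
- by apply: vabsM_lt1l; [exact: iwahori_lower|exact: iwahori_le1].
Qed.

Lemma KprimeM k l : Kprime k -> Kprime l -> Kprime (k * l)%g.
Proof. by move=> /KprimeP kK /KprimeP lK; apply/KprimeP; apply: iwahoriM. Qed.

(** The similitude relation gives k^-1 = - m^-1 J k^T J. Up to signs and the factor m^-1 in 1 + p,
    this reflects [k] in the antidiagonal, which keeps lower entries lower. *)
Lemma KprimeV k : Kprime k -> Kprime k^-1%g.
Proof.
move=> /KprimeP kK; apply/KprimeP; have [m m0 kJ] := gsp4_similitude k.
have m1 := iwahori_similitude kK kJ.
have -> : gsp4_mx k^-1%g = (m^-1)%:M *m (- (Jmx F *m ((gsp4_mx k)^T *m Jmx F))).
  apply: (can_inj (mulmxK (gsp4_unit k))).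
  rewrite /= mulVmx ?gsp4_unit//.
  rewrite -[RHS]mulmxA mulNmx -mulmxA kJ -scalemxAr JJ scalerN opprK.
  by rewrite mul_scalar_mx scalerA mulVf// scale1r.
apply: iwahoriM; first by apply/scalar_iwahori/vabs_invrB1.
move=> i j; rewrite mxE JmxM MJmx mxE.
have signE (P : pred R) x : P (vabs x) -> forall b c : bool,
    P (vabs (- ((if b then 1 else -1) * (- (if c then 1 else -1) * x)))).
  by move=> Px b c; rewrite vabsN !vabsM !vabsN; case: b; case: c;
    rewrite ?vabsN ?vabs1 !mul1r.
split; first exact: (signE (fun r => r <= 1) _ (iwahori_le1 _ _ kK)).
rewrite leq_eqVlt => /orP[/eqP/val_inj ->|ji].
  rewrite eqxx; set x := _ - 1; have -> : x = gsp4_mx k (rev_ord i) (rev_ord i) - 1.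
    by rewrite /x; case: ifP => _; ring.
  exact: iwahori_diag.
rewrite -val_eqE gtn_eqF// subr0.
apply: (signE (fun r => r < 1)); apply: iwahori_lower => //=.
by move: ji (ltn_ord i); rewrite /=; lia.
Qed.

End Iwahori.

(** * The group H' *)

Section GroupHprime.
Context {R : realType} {F : nonarchimedeanLocalField R}.
Implicit Types (x y : F) (M N : 'M[F]_4) (g h k z : gsp4 F).
Variables (w t : F).
Hypotheses (w_unif : uniformizer w) (t_unit : unitsO F t).

Let w0 : w != 0 := uniformizer_neq0 w_unif.

Lemma unitsO_neq0 (c : F) : unitsO F c -> c != 0.
Proof. by rewrite -vabs_gt0 => ->. Qed.

Lemma gsp4_central_scalarF z : gsp4_center z -> exists2 c : F, c != 0 & gsp4_mx z = c%:M.
Proof. exact/gsp4_central_scalar/lf_char0. Qed.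

Lemma gsp4_center1 : gsp4_center (1%g : gsp4 F).
Proof. by move=> g; rewrite mul1g mulg1. Qed.

Lemma gsp4_centerM (y z : gsp4 F) : gsp4_center y -> gsp4_center z -> gsp4_center (y * z)%g.
Proof. by move=> yC zC g; rewrite -mulgA (zC g) mulgA (yC g) mulgA. Qed.

Lemma gsp4_centerV z : gsp4_center z -> gsp4_center z^-1%g.
Proof.
by move=> zC g; apply: (mulgI z); rewrite mulVKg mulgA zC -mulgA mulgV mulg1.
Qed.

Lemma Kprime1 : Kprime (1%g : gsp4 F).
Proof. by apply/KprimeP; apply: scalar_iwahori; rewrite subrr vabs0. Qed.

(** The square is the scalar - w / t. Together with the normalization of H, this makes H and its
    coset by [gchi] a group. *)
Lemma gchi_sq_central : gsp4_center (gchi w t * gchi w t)%g.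
Proof.
apply: (@gsp4_scalar_central _ _ (- (w / t))); rewrite gsp4M toG_gchi ?(unitsO_neq0 t_unit)//.
apply/matrixP => i j; rewrite !mxE sum_ord4 !mx4E.
by elim/ord4_ind: i; elim/ord4_ind: j => /=; rewrite ?(mulr1n, mulr0n); ring.
Qed.

(** Up to signs, and with v = w / t, conjugation exchanges the diagonal 2x2 blocks, sends the lower
    left block divided by v to the upper right, and the upper right block times v to the lower left.
    Since v generates p, integrality and congruences are kept. *)
Lemma gchi_conj_Kprime k : Kprime k -> Kprime (gchi w t * k * (gchi w t)^-1)%g.
Proof.
move=> /KprimeP kK; apply/KprimeP; set l := (_ * _ * _)%g.
have t0 := unitsO_neq0 t_unit.
have [v vdef] : exists v, v = w / t by exists (w / t).
have v0 : v != 0 by rewrite vdef mulf_neq0 ?invr_neq0.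
have vE : vabs v = (fq F)^-1.
  by rewrite vdef vabsM vabsV t_unit invr1 mulr1 uniformizer_vabs.
have v1 : vabs v < 1 by rewrite vabs_lt1 vE.
have shrink x : vabs x <= 1 -> vabs (v * x) < 1 by exact: vabsM_lt1l.
have grow x : vabs x < 1 -> vabs (v^-1 * x) <= 1.
  rewrite vabs_lt1 -vE vabsM vabsV => xv.
  by rewrite mulrC ler_pdivrMr ?vabs_gt0// mul1r.
set M := gsp4_mx k in kK *.
have gV : gsp4_mx (gchi w t)^-1%g = mx4 [:: [:: 0; 0; - v^-1; 0];
    [:: 0; 0; 0; v^-1]; [:: 1; 0; 0; 0]; [:: 0; -1; 0; 0]].
  apply: (can_inj (mulKmx (gsp4_unit (gchi w t)))).
  rewrite -gsp4M mulgV toG_gchi// -vdef; apply/matrixP => i j; rewrite !mxE sum_ord4 !mx4E.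
  by elim/ord4_ind: i; elim/ord4_ind: j => /=; field.
have lE : gsp4_mx l = mx4
    [:: [:: M o2 o2; - M o2 o3; - (v^-1 * M o2 o0); v^-1 * M o2 o1];
        [:: - M o3 o2; M o3 o3; v^-1 * M o3 o0; - (v^-1 * M o3 o1)];
        [:: - (v * M o0 o2); v * M o0 o3; M o0 o0; - M o0 o1];
        [:: v * M o1 o2; - (v * M o1 o3); - M o1 o0; M o1 o1]].
  rewrite !gsp4M gV toG_gchi// -vdef -/M; apply/matrixP => i j.
  rewrite mxE sum_ord4 !mxE !sum_ord4 !mx4E.
  by elim/ord4_ind: i; elim/ord4_ind: j => /=; field.
have up i j : vabs (M i j) <= 1 by exact: iwahori_le1.
have dg i : vabs (M i i - 1) < 1 by exact: iwahori_diag.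
have lo (i j : 'I_4) : (j < i)%N -> vabs (M i j) < 1 by exact: iwahori_lower.
have upV (i j : 'I_4) : (j < i)%N -> vabs (v^-1 * M i j) <= 1 by move=> /lo/grow.
have loV i j : vabs (v * M i j) < 1 by exact: shrink.
move=> i j; rewrite lE mx4E.
elim/ord4_ind: i; elim/ord4_ind: j => /=; rewrite ?(mulr1n, mulr0n, subr0) ?vabsN;
  split=> //; try (by move=> _; exact: lo); try (by apply: ltW; exact: loV);
  exact: upV.
Qed.

(** The square of [gchi] is central, so conjugation by it and by its inverse agree. *)
Lemma gchi_conj_KprimeV k : Kprime k -> Kprime ((gchi w t)^-1 * k * gchi w t)%g.
Proof.
move=> kK; suff <- : (gchi w t * k * (gchi w t)^-1 =
    (gchi w t)^-1 * k * gchi w t)%g by exact: gchi_conj_Kprime.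
apply: (mulgI (gchi w t)); apply: (mulIg (gchi w t)).
rewrite !mulgA mulgVK mulgV mul1g -[RHS]mulgA.
exact: gchi_sq_central.
Qed.

Lemma HgrpM g h : Hgrp g -> Hgrp h -> Hgrp (g * h)%g.
Proof.
move=> [y [k [yC kK ->]]] [z [l [zC lK ->]]]; exists (y * z)%g, (k * l)%g.
split; [exact: gsp4_centerM|exact: KprimeM|].
by rewrite -!mulgA; congr (_ * _)%g; rewrite !mulgA zC.
Qed.

Lemma HgrpV h : Hgrp h -> Hgrp h^-1%g.
Proof.
move=> [z [k [zC kK ->]]]; exists z^-1%g, k^-1%g.
split; [exact: gsp4_centerV|exact: KprimeV|].
by rewrite invgM; exact: esym (gsp4_centerV zC _).
Qed.

Lemma Hgrp_center z : gsp4_center z -> Hgrp z.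
Proof. by move=> zC; exists z, 1%g; split; rewrite ?mulg1//; exact: Kprime1. Qed.

Lemma Hgrp_Kprime k : Kprime k -> Hgrp k.
Proof. by move=> kK; exists 1%g, k; split; rewrite ?mul1g//; exact: gsp4_center1. Qed.

Lemma gchi_conj_Hgrp h : Hgrp h -> Hgrp ((gchi w t)^-1 * h * gchi w t)%g.
Proof.
move=> [z [k [zC kK ->]]]; exists z, ((gchi w t)^-1 * k * gchi w t)%g.
split=> //; first exact: gchi_conj_KprimeV.
by rewrite !mulgA -(zC (gchi w t)^-1%g).
Qed.

Lemma gchi_conj_HgrpV h : Hgrp h -> Hgrp (gchi w t * h * (gchi w t)^-1)%g.
Proof.
move=> [z [k [zC kK ->]]]; exists z, (gchi w t * k * (gchi w t)^-1)%g.
split=> //; first exact: gchi_conj_Kprime.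
by rewrite !mulgA -(zC (gchi w t)).
Qed.

Lemma HprimeP h : Hprime w t h <-> Hgrp h \/ Hgrp ((gchi w t)^-1 * h)%g.
Proof.
split=> [[|[k kH <-]]|[|kH]]; [by left|by right; rewrite mulKg|by left|right].
by exists ((gchi w t)^-1 * h)%g => //; rewrite mulVKg.
Qed.

Lemma HprimeM g h : Hprime w t g -> Hprime w t h -> Hprime w t (g * h)%g.
Proof.
move=> [gH|[k kH <-]] [hH|[l lH <-]].
- by left; exact: HgrpM.
- right; exists (((gchi w t)^-1 * g * gchi w t) * l)%g.
    by apply: HgrpM => //; exact: gchi_conj_Hgrp.
  by rewrite !mulgA mulgV mul1g.
- by right; exists (k * h)%g; rewrite ?mulgA//; exact: HgrpM.
- left; have -> : (gchi w t * k * (gchi w t * l) =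
      gchi w t * gchi w t * (((gchi w t)^-1 * k * gchi w t) * l))%g.
    by rewrite !mulgA mulgK.
  apply: HgrpM; first exact/Hgrp_center/gchi_sq_central.
  by apply: HgrpM => //; exact: gchi_conj_Hgrp.
Qed.

Lemma HprimeV h : Hprime w t h -> Hprime w t h^-1%g.
Proof.
move=> [hH|[k kH <-]]; first by left; exact: HgrpV.
right; exists ((gchi w t * gchi w t)^-1 * (gchi w t * k^-1 * (gchi w t)^-1))%g.
  apply: HgrpM; first exact/Hgrp_center/gsp4_centerV/gchi_sq_central.
  exact/gchi_conj_HgrpV/HgrpV.
by rewrite !invgM !mulgA mulgV mul1g mulVg mul1g.
Qed.

Lemma Hprime_mull g h : Hprime w t g -> Hprime w t (g * h)%g <-> Hprime w t h.
Proof.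
move=> gH; split; last exact: HprimeM.
by move=> ghH; rewrite -(mulKg g h); apply: HprimeM => //; exact: HprimeV.
Qed.

End GroupHprime.

(** * The character of H *)

(** For r > 1, Bernoulli's inequality makes the powers of r grow at least linearly. *)
Lemma bounded_powers_le1 (R : realType) (r M : R) :
  (forall n, r ^+ n <= M) -> r <= 1.
Proof.
move=> rM; rewrite leNgt; apply/negP => r1.
have d0 : 0 < r - 1 by rewrite subr_gt0.
have bern n : 1 + n%:R * (r - 1) <= r ^+ n.
  elim: n => [|n IH]; first by rewrite mul0r addr0.
  rewrite exprS; apply: le_trans (ler_wpM2l (ltW (lt_trans ltr01 r1)) IH).
  have : 0 <= n%:R * (r - 1) ^+ 2 by rewrite mulr_ge0// sqr_ge0.
  by rewrite -[n.+1]addn1 natrD; nra.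
have := le_trans (bern (Num.bound (`|M| / (r - 1)))) (rM _).
have : `|M| / (r - 1) < (Num.bound (`|M| / (r - 1)))%:R.
  by apply: archi_boundP; rewrite divr_ge0// ltW.
rewrite ltr_pdivrMr// => MN bM; have := ler_norm M; lra.
Qed.

Section Character.
Context {R : realType} {F : nonarchimedeanLocalField R}.
Implicit Types (x y : F) (g h k z : gsp4 F).
Variables (w t : F) (psi : F -> R[i]).
Hypotheses (w_unif : uniformizer w) (t_unit : unitsO F t).
Hypotheses (psi_char : additive_character psi) (psi_o : trivial_on (ringO F) psi).

Let w0 : w != 0 := uniformizer_neq0 w_unif.

Lemma psiD x y : psi (x + y) = psi x * psi y. Proof. exact: psi_char.2. Qed.
Lemma psi_neq0 x : psi x != 0. Proof. exact: psi_char.1. Qed.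
Lemma psi_0 : psi 0 = 1. Proof. by apply: psi_o; rewrite /ringO /= vabs0. Qed.
Lemma psiN x : psi (- x) = (psi x)^-1.
Proof. by apply: (mulfI (psi_neq0 x)); rewrite -psiD subrr mulfV ?psi_neq0// psi_0. Qed.

Lemma psi_mulrn x n : psi (x *+ n) = psi x ^+ n.
Proof. by elim: n => [|n IH]; rewrite ?psi_0// mulrS psiD IH exprS. Qed.

Lemma vabs_mulrn x n : vabs (x *+ n) <= vabs x.
Proof.
by elim: n => [|n IH]; rewrite ?mulr0n ?vabs0 ?vabs_ge0// mulrS vabsD.
Qed.

(* A character of the bounded group p^-1 that is trivial on o takes finitely
   many values, so it is unitary. *)
Lemma psi0_unitary x : vabs x <= 1 -> ComplexField.Normc.normc (psi0 w psi x) = 1.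
Proof.
move=> x1; have [s sP] := @ringO_finite_net R F 1.
have vw := uniformizer_vabs w_unif.
pose nm y := ComplexField.Normc.normc (psi0 w psi y).
have nmE y c : vabs (y - c) <= fq F ^- 1 -> nm y = nm c.
  move=> yc; rewrite /nm /psi0 -[y](subrK c) mulrDr psiD psi_o ?mul1r//.
  rewrite /ringO /= vabsM vabsV vw invrK.
  by rewrite -ler_pdivlMl ?fq_gt0// mulr1.
have nm_ge0 y : 0 <= nm y by rewrite /nm; case: (psi0 _ _ _) => a b; exact: sqrtr_ge0.
have bound y : vabs y <= 1 -> nm y <= \sum_(c <- s) nm c.
  move=> /sP[c cs /nmE ->]; rewrite (big_rem c) //= lerDl; apply: sumr_ge0 => i _; exact: nm_ge0.
have le1 y : vabs y <= 1 -> nm y <= 1.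
  (* Powers of [nm y] are values of [nm] at multiples of y, which stay integral. The reverse
     inequality comes from applying the bound to -x. *)
  move=> y1; apply: (@bounded_powers_le1 _ _ (\sum_(c <- s) nm c)) => n.
  have -> : nm y ^+ n = nm (y *+ n).
    rewrite /nm /psi0 mulrnAr psi_mulrn.
    by elim: n => [|n IH]; rewrite ?expr0 ?ComplexField.Normc.normc1// !exprS IH ComplexField.Normc.normcM.
  apply: bound; exact: le_trans (vabs_mulrn _ _) y1.
apply/eqP; rewrite eq_le le1//= -/(nm x).
have : nm (- x) <= 1 by rewrite le1// vabsN.
rewrite /nm /psi0 mulrN psiN ComplexField.Normc.normcV invf_le1//.
rewrite lt_def nm_ge0 andbT; apply/eqP => /ComplexField.Normc.eq0_normc/eqP.
by rewrite (negPf (psi_neq0 _)).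
Qed.

Lemma psi0D x y : psi0 w psi (x + y) = psi0 w psi x * psi0 w psi y.
Proof. by rewrite /psi0 mulrDr psiD. Qed.

Lemma psi0_eq x y : vabs (x - y) < 1 -> psi0 w psi x = psi0 w psi y.
Proof.
move=> xy; rewrite -[x](subrK y) psi0D /psi0 psi_o ?mul1r// /ringO /= vabsM vabsV.
rewrite (uniformizer_vabs w_unif) invrK -ler_pdivlMl ?fq_gt0// mulr1.
by rewrite -vabs_lt1.
Qed.

(* chi(z k) = psi0 (affine_part k), see [chiHE] *)
Definition affine_part k : F :=
  gsp4_mx k o0 o1 + gsp4_mx k o1 o2 + t * w^-1 * gsp4_mx k o3 o0.

Lemma affine_partE k :
  entry k 1 2 + entry k 2 3 + t * w^-1 * entry k 4 1 = affine_part k.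
Proof.
by have := (entryE k o0 o1, entryE k o1 o2, entryE k o3 o0); move=> /= [[-> ->] ->].
Qed.

Lemma affine_part_le1 k : Kprime k -> vabs (affine_part k) <= 1.
Proof.
move=> /KprimeP kK; apply: vabsD; first by apply: vabsD; exact: iwahori_le1.
have := iwahori_lower kK (isT : (o0 < o3)%N).
rewrite vabs_lt1 !vabsM vabsV t_unit mul1r (uniformizer_vabs w_unif) invrK.
by rewrite -ler_pdivlMl ?fq_gt0// mulr1.
Qed.

(** Additivity modulo p is what makes chi multiplicative on K'. The corrections in the (4,1) entry
    are products of two elements of p, so they stay in p after division by [w]. *)
Lemma affine_partM k l : Kprime k -> Kprime l ->
  vabs (affine_part (k * l)%g - (affine_part k + affine_part l)) < 1.
Proof.
move=> /KprimeP kK /KprimeP lK; rewrite /affine_part gsp4M !mxE !sum_ord4.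
set A := gsp4_mx k in kK *; set B := gsp4_mx l in lK *.
have a1 i j : vabs (A i j) <= 1 by exact: iwahori_le1.
have b1 i j : vabs (B i j) <= 1 by exact: iwahori_le1.
have al (i j : 'I_4) : (j < i)%N -> vabs (A i j) < 1 by exact: iwahori_lower.
have bl (i j : 'I_4) : (j < i)%N -> vabs (B i j) < 1 by exact: iwahori_lower.
have ad i : vabs (A i i - 1) < 1 by exact: iwahori_diag.
have bd i : vabs (B i i - 1) < 1 by exact: iwahori_diag.
set X := (X in vabs X < 1).
have -> : X = ((A o0 o0 - 1) * B o0 o1 + A o0 o1 * (B o1 o1 - 1) + A o0 o2 * B o2 o1
     + A o0 o3 * B o3 o1)
  + (A o1 o0 * B o0 o2 + (A o1 o1 - 1) * B o1 o2 + A o1 o2 * (B o2 o2 - 1)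
     + A o1 o3 * B o3 o2)
  + t * w^-1 * (A o3 o0 * (B o0 o0 - 1) + A o3 o1 * B o1 o0 + A o3 o2 * B o2 o0
     + (A o3 o3 - 1) * B o3 o0) by rewrite /X; ring.
have PP x y : vabs x < 1 -> vabs y < 1 -> vabs (x * y) <= (fq F)^-1 ^+ 2.
  by rewrite !vabs_lt1 vabsM expr2 => x1 y1; apply: ler_pM; rewrite ?vabs_ge0.
apply: vabsD_lt; first apply: vabsD_lt.
- do ?apply: vabsD_lt; ((by apply: vabsM_lt1l => //; exact: al) ||
    (by apply: vabsM_lt1r => //; exact: bl)).
- do ?apply: vabsD_lt; ((by apply: vabsM_lt1l => //; exact: al) ||
    (by apply: vabsM_lt1r => //; exact: bl)).
rewrite !vabsM vabsV t_unit mul1r (uniformizer_vabs w_unif) invrK.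
rewrite -ltr_pdivlMl ?fq_gt0// mulr1; set S := (S in vabs S).
have /le_lt_trans -> // : vabs S <= (fq F)^-1 ^+ 2.
  by do ?apply: vabsD; apply: PP => //; first [exact: al | exact: bl].
by rewrite expr2 gtr_pMr ?invr_gt0 ?fq_gt0// invf_lt1 ?fq_gt0 ?fq_gt1.
Qed.

(** Independence of the decomposition picked by [xget]: two choices of the K' factor differ by a
    central element, a scalar in 1 + p, whose affine part is 0. *)
Lemma chiHE z k : gsp4_center z -> Kprime k ->
  chiH w psi t (z * k)%g = psi0 w psi (affine_part k).
Proof.
move=> zC kK; rewrite /chiH; set A := (X in xget _ X).
have [kA [y yC E]] : A (xget 1%g A).
  by apply: (@xgetPex _ 1%g); exists k; split => //; exists z.
move: (xget 1%g A) kA E => l lK E; rewrite affine_partE.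
pose u := (y^-1 * z)%g; have lE : l = (u * k)%g by rewrite /u -mulgA E mulKg.
have uC : gsp4_center u by apply: gsp4_centerM => //; exact: gsp4_centerV.
have [c c0 uE] := gsp4_central_scalarF uC.
move/KprimeP : (kK) => kI; move/KprimeP : (lK) => lI.
(* Compare the (1,1) entries of [l] and [k], both in 1 + p. *)
have c1 : vabs (c - 1) < 1.
  have k00 : vabs (gsp4_mx k o0 o0) = 1.
    by apply/unitsP1_vabs/unitsP1E; exact: iwahori_diag.
  have l00 : gsp4_mx l o0 o0 = c * gsp4_mx k o0 o0.
    by rewrite lE gsp4M uE mul_scalar_mx mxE.
  have -> : vabs (c - 1) = vabs (gsp4_mx l o0 o0 - gsp4_mx k o0 o0).
    by rewrite l00 (_ : c * _ - _ = (c - 1) * gsp4_mx k o0 o0) ?vabsM ?k00 ?mulr1//; ring.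
  by apply: vdist_lt (iwahori_diag o0 lI) _; rewrite vabsB; exact: iwahori_diag.
have uK : Kprime u by apply/KprimeP; rewrite uE; exact: scalar_iwahori.
have u_aff : affine_part u = 0.
  by rewrite /affine_part uE !mxE /= !mulr0n mulr0 !addr0.
apply: psi0_eq; rewrite lE.
by have := affine_partM uK kK; rewrite u_aff add0r.
Qed.

Lemma chiHM h k : Hgrp h -> Kprime k ->
  chiH w psi t (h * k)%g = chiH w psi t h * psi0 w psi (affine_part k).
Proof.
move=> [z [l [zC lK ->]]] kK; rewrite -mulgA !chiHE//; last exact: KprimeM.
by rewrite -psi0D; apply: psi0_eq; exact: affine_partM.
Qed.

Lemma chiH_unitary h : Hgrp h -> chiH w psi t h * (chiH w psi t h)^*%C = 1.
Proof.
move=> [z [k [zC kK ->]]]; rewrite chiHE//.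
have := psi0_unitary (affine_part_le1 kK); case: (psi0 _ _ _) => a b /= ab.
have {}ab : a ^+ 2 + b ^+ 2 = 1.
  by rewrite -[LHS]sqr_sqrtr ?addr_ge0 ?sqr_ge0// ab expr1n.
by apply/eqP; rewrite eq_complex /= -ab; apply/andP; split; apply/eqP; ring.
Qed.

Variable sgn : bool.

(** Right multiplication by K' preserves both H and its coset by [gchi], so the same branch of
    [chi_pm] applies to both sides. *)
Lemma chi_pm_Kprime h k : Hprime w t h -> Kprime k ->
  chi_pm w psi t sgn (h * k)%g = chi_pm w psi t sgn h * psi0 w psi (affine_part k).
Proof.
move=> /HprimeP hH kK; rewrite /chi_pm.
have hk : Hgrp (h * k)%g <-> Hgrp h.
  split=> [hkH|hH']; last by apply: HgrpM => //; exact: Hgrp_Kprime.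
  by rewrite -(mulgK k h); apply: HgrpM => //; apply/HgrpV/Hgrp_Kprime.
have -> : ((h * k)%g \in Hgrp) = (h \in Hgrp) by apply/idP/idP; rewrite !inE => /hk.
have [hH'|hNH] := boolP (h \in Hgrp); first by rewrite chiHM//; rewrite inE in hH'.
case: hH => [hH|hH]; first by move: hNH; rewrite notin_setE.
by rewrite mulgA chiHM// mulrA.
Qed.

Lemma chi_pm_unitary h : Hprime w t h ->
  chi_pm w psi t sgn h * (chi_pm w psi t sgn h)^*%C = 1.
Proof.
move=> /HprimeP hH; rewrite /chi_pm.
have [hH'|hNH] := boolP (h \in Hgrp); first by apply: chiH_unitary; rewrite inE in hH'.
case: hH => [hH|hH]; first by move: hNH; rewrite notin_setE.
rewrite rmorphM mulrACA chiH_unitary// mulr1 rmorph_sign.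
by rewrite -expr2 sqrr_sign.
Qed.

(** Unitarity removes the dependence on [h]: the integrand of the matrix coefficient is constant on
    H'. *)
Lemma fmin_Kprime h k : Hprime w t h -> Kprime k ->
  fmin w psi t sgn (h * k)%g * (fmin w psi t sgn h)^*%C =
  psi0 w psi (affine_part k).
Proof.
move=> hH kK; rewrite /fmin !mem_set//; last first.
  by apply: HprimeM => //; left; exact: Hgrp_Kprime.
by rewrite chi_pm_Kprime// mulrAC chi_pm_unitary// mul1r.
Qed.

Lemma fmin_out h : ~ Hprime w t h -> fmin w psi t sgn h = 0.
Proof. by move=> hH; rewrite /fmin memNset. Qed.

End Character.

(** * Topology of GSp(4) *)

Section GroupTopology.
Context {R : realType} {F : nonarchimedeanLocalField R}.
Implicit Types (x y : F) (M N : 'M[F]_4) (g h k z : gsp4 F) (e : R).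
Notation ZG := (ZbackslashG F).
Notation piZ := (\pi_(ZbackslashG F)%qT : gsp4 F -> ZbackslashG F).

Lemma piZ_eq g h : piZ g = piZ h <-> exists2 z, gsp4_center z & h = (z * g)%g.
Proof.
split=> [/eqmodP/asboolP//|H]; apply/eqmodP; exact/asboolP.
Qed.

Lemma repr_piZ g : exists2 z, gsp4_center z & repr (piZ g) = (z * g)%g.
Proof. by apply/piZ_eq; rewrite reprK. Qed.

Lemma piZ_repr (x : ZG) : piZ (repr x) = x. Proof. exact: reprK. Qed.

Lemma nbhs_gsp4 g (A : set (gsp4 F)) e : 0 < e ->
  [set h | forall i j, vabs (gsp4_mx g i j - gsp4_mx h i j) < e] `<=` A -> nbhs g A.
Proof.
move=> e0 /filterS; apply.
have := @initial_continuous (gsp4 F) 'M[F]_4 (@gsp4_mx F) g.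
move=> /(_ [set M : 'M[F]_4 | forall i j, vabs (gsp4_mx g i j - M i j) < e]); apply.
exists (fun i j => [set y : F | vabs (gsp4_mx g i j - y) < e]) => // i j.
by apply/nbhs_vabs; exists e.
Qed.

Lemma mulmx_le M N (a b : R) : 0 <= a -> 0 <= b ->
  (forall i j, vabs (M i j) <= a) -> (forall i j, vabs (N i j) <= b) ->
  forall i j, vabs ((M *m N) i j) <= a * b.
Proof.
move=> a0 b0 Ma Nb i j; rewrite mxE; apply: vabs_sum; first exact: mulr_ge0.
by move=> k _; rewrite vabsM ler_pM ?vabs_ge0.
Qed.

Lemma mx_bound M : exists2 a : R, 0 < a & forall i j, vabs (M i j) <= a.
Proof.
exists (1 + \sum_i \sum_j vabs (M i j)).
  by rewrite ltr_wpDr// !sumr_ge0// => i _; rewrite sumr_ge0// => j _; exact: vabs_ge0.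
move=> i j; rewrite (bigD1 i) //= (bigD1 j) //=.
have S1 : 0 <= \sum_(l < 4 | l != j) vabs (M i l) by rewrite sumr_ge0// => l _; exact: vabs_ge0.
have S2 : 0 <= \sum_(l < 4 | l != i) \sum_j vabs (M l j).
  by rewrite sumr_ge0// => l _; rewrite sumr_ge0// => m _; exact: vabs_ge0.
lra.
Qed.

Lemma iwahoriD M N : iwahori M -> (forall i j, vabs (N i j) < 1) -> iwahori (M + N).
Proof.
move=> MI N1 i j; rewrite mxE; split=> [|ji].
  by apply: vabsD; [exact: iwahori_le1|exact: ltW].
by rewrite addrAC; apply: vabsD_lt => //; case: (MI i j) => _; exact.
Qed.

(** The product depends linearly on [k], so a change of [k] that is small against the entries of [g]
    and [h] alters it by a matrix over p, which the Iwahori conditions absorb. *)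
Lemma open_Kprime_translate g h : open [set k : gsp4 F | Kprime (g * k * h)%g].
Proof.
rewrite openE => k /= /KprimeP kK.
have [a a0 ga] := mx_bound (gsp4_mx g); have [b b0 hb] := mx_bound (gsp4_mx h).
have q1 := @fq_gt1 R F; have q0 := @fq_gt0 R F.
pose e := (fq F)^-1 / (a * b); have e0 : 0 < e by rewrite divr_gt0 ?mulr_gt0 ?invr_gt0.
apply: (@nbhs_gsp4 _ _ e) => // l kl; apply/KprimeP.
have -> : gsp4_mx (g * l * h)%g = gsp4_mx (g * k * h)%g
    + gsp4_mx g *m (gsp4_mx l - gsp4_mx k) *m gsp4_mx h.
  by rewrite !gsp4M mulmxBr mulmxBl addrC subrK.
apply: iwahoriD => // i j; rewrite vabs_lt1.
have -> : (fq F)^-1 = a * e * b by rewrite /e; field; rewrite !gt_eqF.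
apply: mulmx_le => //; [by rewrite mulr_ge0// ltW|exact: ltW|].
apply: mulmx_le => //; [exact: ltW|exact: ltW|] => i' j'.
by rewrite !mxE vabsB; apply: ltW; exact: kl.
Qed.

Lemma vabsM_close x x' y y' e : vabs x <= 1 -> vabs y' <= 1 ->
  vabs (x - x') <= e -> vabs (y - y') <= e -> vabs (x * y - x' * y') <= e.
Proof.
move=> x1 y1 xe ye; have -> : x * y - x' * y' = x * (y - y') + (x - x') * y' by ring.
apply: vabsD; rewrite vabsM.
  by apply: le_trans ye; rewrite ler_piMl ?vabs_ge0.
by apply: le_trans xe; rewrite ler_piMr ?vabs_ge0.
Qed.

(** On integral matrices the form is quadratic with coefficients 0 and ±1, so by the ultrametric
    inequality it does not increase distances. It carries the similitude relation over to limits. *)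
Lemma Jform_close M N e : 0 <= e ->
  (forall i j, vabs (M i j) <= 1) -> (forall i j, vabs (N i j) <= 1) ->
  (forall i j, vabs (M i j - N i j) <= e) -> forall i j,
  vabs ((M^T *m Jmx F *m M) i j - (N^T *m Jmx F *m N) i j) <= e.
Proof.
move=> e0 M1 N1 MN i j; rewrite -!mulmxA !mxE -sumrB; apply: vabs_sum => // k _.
rewrite !JmxM !mxE; apply: vabsM_close => //.
- by rewrite vabsM; case: ifP => _; rewrite ?vabsN vabs1 mul1r.
- by rewrite -mulrBr vabsM; case: ifP => _; rewrite ?vabsN vabs1 mul1r.
Qed.

(** Along an ultrafilter each entry converges, by the compactness of o. The limit matrix satisfies
    the Iwahori conditions and the similitude relation, hence is a point of K' to which the
    ultrafilter converges. *)
Lemma compact_Kprime : compact (@Kprime R F).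
Proof.
rewrite compact_ultra => U UU UK.
have /boolp.choice[L LP] : forall ij : 'I_4 * 'I_4, exists l,
    forall e, 0 < e -> U [set g | vabs (gsp4_mx g ij.1 ij.2 - l) < e].
  move=> ij; apply: (@ultrafilter_ringO_limit _ _ _ _ _ (fun g : gsp4 F => gsp4_mx g ij.1 ij.2)).
  by apply: filterS UK => g /KprimeP gI; exact: iwahori_le1.
pose M : 'M[F]_4 := \matrix_(i, j) L (i, j).
have near e : 0 < e -> U [set g | Kprime g /\ forall i j, vabs (gsp4_mx g i j - M i j) < e].
  move=> e0; apply: filterI => //.
  have : \forall g \near U, forall ij, vabs (gsp4_mx g ij.1 ij.2 - L ij) < e.
    by apply: filter_forall => ij; exact: LP.
  by apply: filterS => g gL i j; rewrite mxE; exact: (gL (i, j)).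
have MI : iwahori M.
  have [g [/KprimeP gK gM]] := filter_ex (near _ ltr01).
  have -> : M = gsp4_mx g + (M - gsp4_mx g) by rewrite addrC subrK.
  by apply: iwahoriD => // i j; rewrite !mxE vabsB; have := gM i j; rewrite mxE.
(* The multiplier is read off at the upper right corner, where J has the entry 1. *)
have [m mE] : exists m, m = (M^T *m Jmx F *m M) ord0 ord_max by eexists.
have MJ : M^T *m Jmx F *m M = m *: Jmx F.
  apply/matrixP => i j; apply/eqP; rewrite -subr_eq0 -vabs_eq0; apply/eqP.
  apply: le_anti; rewrite vabs_ge0 andbT; apply/ler_addgt0Pl => e e0; rewrite addr0.
  (* A member [g] of K' that is e-close to [M] has a genuine multiplier [n], and [n] is then e-close
     to [m]; finally e tends to 0. *)
  have [g [/KprimeP gK gM]] := filter_ex (near _ e0).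
  have [n n0 gJ] := gsp4_similitude g.
  have close i' j' : vabs ((M^T *m Jmx F *m M) i' j' - (n *: Jmx F) i' j') <= e.
    rewrite -gJ; apply: Jform_close; [exact: ltW|by move=> *; exact: iwahori_le1|
      by move=> *; exact: iwahori_le1|].
    by move=> k l; rewrite vabsB; apply: ltW; exact: gM.
  have J03 : Jmx F ord0 ord_max = 1 by rewrite mx4E.
  have mn : vabs (m - n) <= e by have := close ord0 ord_max; rewrite -mE [X in _ - X]mxE J03 mulr1.
  have -> : (M^T *m Jmx F *m M) i j - (m *: Jmx F) i j =
    ((M^T *m Jmx F *m M) i j - (n *: Jmx F) i j) - (m - n) * Jmx F i j.
    have sE (c : F) : (c *: Jmx F) i j = c * Jmx F i j by rewrite mxE.
    by rewrite !sE; ring.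
  apply: vabsBl => //; rewrite vabsM; apply: le_trans mn; rewrite ler_piMr ?vabs_ge0//.
  rewrite mx4E; elim/ord4_ind: i; elim/ord4_ind: j => /=;
    by rewrite ?vabsN ?vabs0 ?vabs1.
have m1 := iwahori_similitude MI MJ.
have m0 : m != 0.
  by rewrite -vabs_gt0 (unitsP1_vabs (proj2 (unitsP1E _) m1)).
have ME := toGK m0 MJ.
exists (toG M : gsp4 F); split; first by apply/KprimeP; rewrite ME.
move=> A [B [[C Co <-] CM CA]].
suff : U (@gsp4_mx F @^-1` C) by exact: filterS.
have : nbhs M C by apply: open_nbhs_nbhs; split => //; rewrite -ME.
move=> [P PM PC].
have : \forall g \near U, forall ij, P ij.1 ij.2 (gsp4_mx g ij.1 ij.2).
  apply: filter_forall => -[i j]; have /nbhs_vabs[e e0 eP] := PM i j.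
  apply: filterS (near _ e0) => g [_ gM]; apply: eP => /=.
  by rewrite vabsB; exact: gM.
by apply: filterS => g gP; apply: PC => i j; exact: (gP (i, j)).
Qed.

End GroupTopology.

(** * Matrix coefficients of the minimal vector *)

Section ComplexIntegral.
Context {R : realType}.

Lemma eq_cintegral d (T : measurableType d) (mu : {measure set T -> \bar R})
    (D : set T) (f g : T -> R[i]) :
  {in D, f =1 g} -> cintegral mu D f = cintegral mu D g.
Proof.
move=> fg; rewrite /cintegral; congr Complex; apply: eq_Rintegral => x xD;
  by rewrite fg.
Qed.

(** Every integral below is evaluated by this formula, once its integrand is shown to be constant on
    a measurable set and zero elsewhere. *)
Lemma cintegral_if d (T : measurableType d) (mu : {measure set T -> \bar R})
    (D A : set T) (c : R[i]) : measurable D -> measurable A ->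
  cintegral mu D (fun x => if x \in A then c else 0) =
  c * (fine (mu (D `&` A)))%:C%C.
Proof.
move=> mD mA; have mDA : measurable (D `&` A) by exact: measurableI.
rewrite /cintegral; case: c => a b.
have E (r : R) : \int[mu]_(x in D) (if x \in A then r else 0) = r * fine (mu (D `&` A)).
  by rewrite -Rintegral_cst// Rintegral_mkcondr.
apply/eqP; rewrite eq_complex /= !mulr0 subr0 add0r -!E; apply/andP.
by split; apply/eqP; apply: eq_Rintegral => x _; case: ifP.
Qed.

End ComplexIntegral.

(** * Volume of Z\H' and the inner product of translates of the minimal vector *)

Section InnerProduct.
Context {R : realType} {F : nonarchimedeanLocalField R}.
Implicit Types (x y : F) (g h k z : gsp4 F).
Variables (w t : F) (psi : F -> R[i]).
Hypotheses (w_unif : uniformizer w) (t_unit : unitsO F t).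
Hypotheses (psi_char : additive_character psi) (psi_o : trivial_on (ringO F) psi).
Variable dg : {measure set (borel (ZbackslashG F)) -> \bar R}.
Hypothesis dg_haar : quotient_haar dg.
Notation ZG := (ZbackslashG F).
Notation piZ := (\pi_(ZbackslashG F)%qT : gsp4 F -> ZbackslashG F).

Lemma HgrpE h : Hgrp h <-> exists2 z, gsp4_center z & Kprime (z * h)%g.
Proof.
split=> [[z [k [zC kK ->]]]|[z zC kK]].
  by exists z^-1%g; [exact: gsp4_centerV|rewrite mulKg].
exists z^-1%g, (z * h)%g; split=> //; [exact: gsp4_centerV|by rewrite mulKg].
Qed.

Lemma Hgrp_centerM z h : gsp4_center z -> Hgrp h -> Hgrp (z * h)%g.
Proof. by move=> zC; apply: HgrpM; exact: Hgrp_center. Qed.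

Lemma Hprime_centerM z h : gsp4_center z -> Hprime w t h -> Hprime w t (z * h)%g.
Proof. by move=> zC; apply: HprimeM => //; left; exact: Hgrp_center. Qed.

Section LeftInvariantSet.
Variable P : set (gsp4 F).
Hypothesis P_center : forall z h, gsp4_center z -> P h -> P (z * h)%g.

(** The representative differs from [g] by a central factor, which [P] absorbs; subsets of Z\G can
    thus be described through [repr]. *)
Lemma repr_piZP g h : P (repr (piZ g) * h)%g <-> P (g * h)%g.
Proof.
have [z zC ->] := repr_piZ g; rewrite -mulgA; split=> [/(P_center (gsp4_centerV zC))|].
  by rewrite mulKg.
exact: P_center.
Qed.

Lemma piZ_image : piZ @` P = [set x : ZG | P (repr x)].
Proof.
apply/seteqP; split=> [_ [h hP <-]|x xP] /=.
  by rewrite -[repr _]mulg1; apply/repr_piZP; rewrite mulg1.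
by exists (repr x) => //; exact: piZ_repr.
Qed.

Lemma rtranslate_piZ_image g :
  ZG_rtranslate g @` (piZ @` P) = [set x : ZG | P (repr x * g^-1)%g].
Proof.
rewrite piZ_image; apply/seteqP; split=> [_ [x xP <-]|x xP] /=.
  by apply/repr_piZP; rewrite mulgK.
exists (piZ (repr x * g^-1)%g).
  by rewrite /= -[repr _]mulg1; apply/repr_piZP; rewrite mulg1.
rewrite -[RHS]piZ_repr; apply/piZ_eq.
have [z zC ->] := repr_piZ (repr x * g^-1)%g; exists z^-1%g; first exact: gsp4_centerV.
by rewrite -mulgA mulgVK mulKg.
Qed.

End LeftInvariantSet.

(** H is the union of the translates of the open set K' by the center. *)
Lemma open_Hgrp_translate g h : open [set k : gsp4 F | Hgrp (g * k * h)%g].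
Proof.
rewrite (_ : mkset _ = \bigcup_(z in gsp4_center)
    [set k : gsp4 F | Kprime (z * g * k * h)%g]); last first.
  apply/seteqP; split=> k /=; first by move=> /HgrpE[z zC]; rewrite !mulgA; exists z.
  by move=> [z zC] /= kK; apply/HgrpE; exists z; rewrite // !mulgA.
by apply: bigcup_open => z _; exact: open_Kprime_translate.
Qed.

Lemma open_Hgrp_quotient h : open [set x : ZG | Hgrp (repr x * h)%g].
Proof.
suff : open (piZ @^-1` [set x : ZG | Hgrp (repr x * h)%g]) by [].
rewrite (_ : _ @^-1` _ = [set k | Hgrp (1 * k * h)%g]).
  exact: open_Hgrp_translate.
by apply/seteqP; split=> k /=; rewrite mul1g => /(repr_piZP Hgrp_centerM).
Qed.

(** The variant of [HprimeP] with [gchi] on the right, where it can be absorbed by a right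
    translation of Z\G. *)
Lemma HprimeE h : Hprime w t h <-> Hgrp h \/ Hgrp (h * (gchi w t)^-1)%g.
Proof.
split=> [/HprimeP[]|[]] hH.
- by left.
- by right; have := gchi_conj_HgrpV w_unif t_unit hH; rewrite mulVKg.
- by left.
- apply/HprimeP; right; have := gchi_conj_Hgrp w_unif t_unit hH.
  by rewrite mulgA mulgVK.
Qed.

Lemma open_Hprime_quotient h : open [set x : ZG | Hprime w t (repr x * h)%g].
Proof.
rewrite (_ : mkset _ = [set x : ZG | Hgrp (repr x * h)%g] `|`
    [set x : ZG | Hgrp (repr x * (h * (gchi w t)^-1))%g]).
  by apply: openU; exact: open_Hgrp_quotient.
by apply/seteqP; split=> x /=; rewrite mulgA; apply HprimeE.
Qed.

Lemma open_piZ_Hprime : open (piZ @` Hprime w t).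
Proof.
rewrite (piZ_image Hprime_centerM).
by have := open_Hprime_quotient 1%g; under eq_set do rewrite mulg1.
Qed.

Lemma open_piZ_Hgrp : open (piZ @` @Hgrp R F).
Proof.
rewrite (piZ_image Hgrp_centerM).
by have := open_Hgrp_quotient 1%g; under eq_set do rewrite mulg1.
Qed.

Lemma volume_Hprime_gt0 : (0 < dg (piZ @` Hprime w t))%E.
Proof.
have [_ _ dg0] := dg_haar; apply: dg0; first exact: open_piZ_Hprime.
exists (piZ 1%g), 1%g => //.
by left; apply: Hgrp_center; exact: gsp4_center1.
Qed.

(** H has the same image in Z\G as the compact group K', and H' adds only one right translate of
    that image. *)
Lemma volume_Hprime_fin : (dg (piZ @` Hprime w t) < +oo)%E.
Proof.
have [dgM dg_cpt _] := dg_haar.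
have HE : piZ @` Hprime w t = (piZ @` @Hgrp R F) `|`
    ZG_rtranslate (gchi w t) @` (piZ @` @Hgrp R F).
  rewrite (rtranslate_piZ_image Hgrp_centerM) !piZ_image.
  - by apply/seteqP; split=> x /=; apply HprimeE.
  - exact: Hgrp_centerM.
  - exact: Hprime_centerM.
have mH : measurable (piZ @` @Hgrp R F : set (borel ZG)).
  apply: (@borel_open ZG); exact: open_piZ_Hgrp.
have mH' : measurable (ZG_rtranslate (gchi w t) @` (piZ @` @Hgrp R F) : set (borel ZG)).
  rewrite (rtranslate_piZ_image Hgrp_centerM).
  apply: (@borel_open ZG); exact: open_Hgrp_quotient.
have finH : (dg (piZ @` @Hgrp R F) < +oo)%E.
  apply: dg_cpt; rewrite (_ : _ @` _ = piZ @` @Kprime R F).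
    apply: continuous_compact; last exact: compact_Kprime.
    by apply: continuous_subspaceT; exact: pi_continuous.
  apply/seteqP; split=> [_ [_ [z [k [zC kK ->]]] <-]|_ [k kK <-]].
    by exists k => //; apply/piZ_eq; exists z.
  by exists k => //; exact: Hgrp_Kprime.
have finH' : (dg (ZG_rtranslate (gchi w t) @` (piZ @` @Hgrp R F)) < +oo)%E.
  by rewrite dgM.
rewrite HE; apply: le_lt_trans (measureU2 _ mH mH') _.
exact: lte_add_pinfty.
Qed.

Lemma volume_Hprime_translate g :
  dg [set x : ZG | Hprime w t (repr x * g)%g] = dg (piZ @` Hprime w t).
Proof.
have [dgM _ _] := dg_haar.
rewrite -(dgM g^-1%g (piZ @` Hprime w t)); last by apply: (@borel_open ZG); exact: open_piZ_Hprime.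
by rewrite (rtranslate_piZ_image Hprime_centerM) invgK.
Qed.

Variable sgn : bool.

(** With h = x d the integrand is f(h y) times the conjugate of f(h), supported on h in H'. There it
    is constant: chi(y) if y is in K', and 0 if y is outside H'. The volume of the support cancels
    the normalization. *)
Lemma inner_product_fmin g d :
  (Hprime w t (d^-1 * g)%g -> Kprime (d^-1 * g)%g) ->
  inner_product w t dg (raction g (fmin w psi t sgn)) (raction d (fmin w psi t sgn)) =
  if `[< Kprime (d^-1 * g)%g >] then psi0 w psi (affine_part w t (d^-1 * g)%g) else 0.
Proof.
set y := (d^-1 * g)%g => yHK; have gE : g = (d * y)%g by rewrite /y mulVKg.
rewrite /inner_product /raction; set c := if _ then _ else _.
rewrite (@eq_cintegral _ _ _ _ _ _
  (fun x : borel ZG => if x \in [set x : ZG | Hprime w t (repr x * d)%g] then c else 0)).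
  rewrite cintegral_if//; last by apply: (@borel_open ZG); exact: open_Hprime_quotient.
  rewrite setTI volume_Hprime_translate mulrCA -[X in _ * X]rmorphM.
  rewrite mulVf ?mulr1//; apply: lt0r_neq0; apply: fine_gt0.
  by rewrite volume_Hprime_gt0 volume_Hprime_fin.
move=> x _; rewrite gE mulgA; set h := (repr (x : ZG) * d)%g.
rewrite /c; case: ifPn; rewrite ?inE ?notin_setE /= => hH; last first.
  by rewrite [fmin _ _ _ _ h]fmin_out// conjc0 mulr0.
case: asboolP => yK; first exact: fmin_Kprime.
rewrite fmin_out ?mul0r// => /(Hprime_mull w_unif t_unit y hH) /yHK.
exact: yK.
Qed.

End InnerProduct.

(** * The Whittaker function *)

Section Whittaker.
Context {R : realType} {F : nonarchimedeanLocalField R}.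
Implicit Types (x y : F) (g h k z : gsp4 F).
Variables (w t : F) (psi : F -> R[i]).
Hypotheses (w_unif : uniformizer w) (t_unit : unitsO F t).
Hypotheses (psi_char : additive_character psi) (psi_o : trivial_on (ringO F) psi).

Let w0 : w != 0 := uniformizer_neq0 w_unif.
Let t0 : t != 0 := unitsO_neq0 t_unit.

Lemma gsp4_mulVK g h : gsp4_mx g *m gsp4_mx (g^-1 * h)%g = gsp4_mx h.
Proof. by rewrite -[LHS]/(gsp4_mx (g * (g^-1 * h))%g) mulVKg. Qed.

(** If h = z k, the last diagonal entry forces the scalar z into 1 + p. If h = [gchi] z k, the (4,2)
    entry is w / t times the scalar z times a unit, which is not zero. *)
Lemma Hprime_last_row h : Hprime w t h ->
  gsp4_mx h o3 o1 = 0 -> gsp4_mx h o3 o3 = 1 -> Kprime h.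
Proof.
have kkE z k i j c : gsp4_mx z = c%:M ->
    gsp4_mx (z * k)%g i j = c * gsp4_mx k i j.
  by move=> zE; rewrite gsp4M zE mul_scalar_mx mxE.
have diag_unit k i : Kprime k -> vabs (gsp4_mx k i i) = 1.
  by move=> /KprimeP kK; apply/unitsP1_vabs/unitsP1E/iwahori_diag.
move=> [[z [k [zC kK hE]]]|[l [z [k [zC kK lE]]] hE]] h31 h33.
  have [c c0 zE] := gsp4_central_scalarF zC.
  rewrite hE; apply: KprimeM => //; apply/KprimeP; rewrite zE; apply: scalar_iwahori.
  have k33 := diag_unit _ o3 kK; have k0 : gsp4_mx k o3 o3 != 0 by rewrite -vabs_gt0 k33.
  have -> : c = (gsp4_mx k o3 o3)^-1.
    by apply: (mulIf k0); rewrite mulVf// -(kkE z k o3 o3 c)// -hE.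
  by apply: vabs_invrB1; apply: iwahori_diag; apply/KprimeP.
have [c c0 zE] := gsp4_central_scalarF zC.
have : w / t * (c * gsp4_mx k o1 o1) = 0.
  rewrite -h31 -hE lE gsp4M toG_gchi// mxE sum_ord4 !mx4E /= !mul0r !addr0 add0r.
  by rewrite (kkE _ _ _ _ c).
move/eqP; rewrite !mulf_eq0 invr_eq0 (negPf w0) (negPf t0) (negPf c0) /=.
by rewrite -vabs_eq0 diag_unit// oner_eq0.
Qed.

(* The matrix d'^-1 u g d_{alpha,beta}, where (a, b, c, e) are the coordinates of
   d'^-1 u d' and p = alpha w c1, r = gamma beta w c2, X = x beta. *)
Definition coset_mx (p r X a b c e : F) : 'M[F]_4 := mx4
  [:: [:: r * p ^+ 2; (a * r + (b + a * e) * X) * p; (b + a * e) * p; c + a * b];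
      [:: 0; (r + e * X) * p; e * p; b];
      [:: 0; X * p; p; - a];
      [:: 0; 0; 0; 1]].

Section Coset.
Variables (p r X a b c e : F).
Let Y := coset_mx p r X a b c e.

(** The conditions are separated by reading p, X, a, b, e off single entries first; r then comes
    from the (2,2) entry and c from the (1,4) entry. *)
Lemma coset_iwahori : iwahori Y <->
  [/\ vabs (p - 1) < 1, vabs (r - 1) < 1 & vabs X < 1] /\
  [/\ vabs a <= 1, vabs b <= 1, vabs c <= 1 & vabs e <= 1].
Proof.
split=> [YI|[[p1 r1 X1] [a1 b1 c1 e1]]].
  have p1 : vabs (p - 1) < 1 by have := iwahori_diag o2 YI; rewrite mx4E.
  have pu : vabs p = 1 by apply/unitsP1_vabs/unitsP1E.
  have X1 : vabs X < 1.
    by have := iwahori_lower YI (isT : (o1 < o2)%N); rewrite mx4E /= vabsM pu mulr1.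
  have a1 : vabs a <= 1 by have := iwahori_le1 o2 o3 YI; rewrite mx4E /= vabsN.
  have b1 : vabs b <= 1 by have := iwahori_le1 o1 o3 YI; rewrite mx4E.
  have e1 : vabs e <= 1.
    by have := iwahori_le1 o1 o2 YI; rewrite mx4E /= vabsM pu mulr1.
  split; split=> //.
    have := iwahori_diag o1 YI; rewrite mx4E /= => H.
    have -> : r - 1 = p^-1 * (((r + e * X) * p - 1) - (p - 1)) - e * X.
      by field; rewrite -vabs_gt0 pu.
    apply: vabsBl_lt; last exact: vabsM_lt1r.
    by rewrite vabsM vabsV pu invr1 mul1r; exact: vabsBl_lt.
  have := iwahori_le1 o0 o3 YI; rewrite mx4E /= => H.
  by rewrite -(addrK (a * b) c); apply: vabsBl => //; exact: vabsM_le1.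
have pu : vabs p = 1 by apply/unitsP1_vabs/unitsP1E.
have ru : vabs r = 1 by apply/unitsP1_vabs/unitsP1E.
have ple : vabs p <= 1 by rewrite pu.
have rle : vabs r <= 1 by rewrite ru.
have Xle : vabs X <= 1 by exact: ltW.
have bae : vabs (b + a * e) <= 1 by apply: vabsD => //; exact: vabsM_le1.
have rpp : vabs (r * p ^+ 2 - 1) < 1.
  have -> : r * p ^+ 2 - 1 = r * (p + 1) * (p - 1) + (r - 1) by ring.
  apply: vabsD_lt => //; apply: vabsM_lt1r => //; apply: vabsM_le1 => //.
  by apply: vabsD => //; rewrite vabs1.
have rexp : vabs ((r + e * X) * p - 1) < 1.
  have -> : (r + e * X) * p - 1 = (r + e * X) * (p - 1) + ((r - 1) + e * X) by ring.
  have eX : vabs (e * X) < 1 by exact: vabsM_lt1r.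
  apply: vabsD_lt; last exact: vabsD_lt.
  by apply: vabsM_lt1r => //; apply: vabsD => //; exact: ltW.
have one_close y : vabs (y - 1) < 1 -> vabs y <= 1.
  by move=> y1; rewrite (unitsP1_vabs (proj2 (unitsP1E _) y1)).
move=> i j; rewrite mx4E; elim/ord4_ind: i; elim/ord4_ind: j => /=;
  rewrite ?(mulr1n, mulr0n, subr0, vabsN, vabs0, vabs1, subrr) ?ler01 ?ltr01 //;
  split=> //; try exact: one_close.
- apply: vabsM_le1 => //; apply: vabsD; exact: vabsM_le1.
- exact: vabsM_le1.
- by apply: vabsD => //; exact: vabsM_le1.
- exact: vabsM_le1.
- exact: vabsM_le1.
- by move=> _; exact: vabsM_lt1l.
Qed.

(** The (4,1) entry is 0, and since p and r are 1 and X is 0 modulo the maximal ideal, the (1,2) and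
    (2,3) entries reduce to a and e. *)
Lemma coset_affine_part k : gsp4_mx k = Y -> iwahori Y ->
  vabs (affine_part w t k - (a + e)) < 1.
Proof.
move=> yE /coset_iwahori[[p1 r1 X1] [a1 b1 c1 e1]].
rewrite /affine_part yE !mx4E /= mulr0 addr0.
have pu : vabs p <= 1 by rewrite (unitsP1_vabs (proj2 (unitsP1E _) p1)).
have ru : vabs r <= 1 by rewrite (unitsP1_vabs (proj2 (unitsP1E _) r1)).
have -> : (a * r + (b + a * e) * X) * p + e * p - (a + e) =
  (a * r + e) * (p - 1) + a * (r - 1) + (b + a * e) * p * X by ring.
apply: vabsD_lt; first apply: vabsD_lt; apply: vabsM_lt1r => //.
  by apply: vabsD => //; exact: vabsM_le1.
by apply: vabsM_le1 => //; apply: vabsD => //; exact: vabsM_le1.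
Qed.

End Coset.

Variable dg : {measure set (borel (ZbackslashG F)) -> \bar R}.
Hypothesis dg_haar : quotient_haar dg.
Variable dx : {sigma_finite_measure set (borel F) -> \bar R}.
Hypothesis dx_haar : additive_haar dx.
Variables (sgn : bool) (c1 c2 alpha beta : F).
Hypotheses (c1_unit : unitsO F c1) (c2_unit : unitsO F c2).
Hypotheses (alpha_neq0 : alpha != 0) (beta_neq0 : beta != 0).

Let A := w^-1 * c1^-1.
Let B := w^-1 * c2^-1.

(** Conjugation of u by [dmat A B] divides its coordinates a, b, c, e by A, A B, A^2 B, B. The
    identity is checked after multiplication by [dmat A B], which avoids its inverse. *)
Lemma matrix_coefficient (g x a b c e : F) : g != 0 ->
  gsp4_mx ((dmat A B)^-1 * (umat a b c e * zetamat g x * dmat alpha beta))%g =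
  coset_mx (alpha / A) (g * beta / B) (x * beta)
    (a / A) (b / (A * B)) (c / (A ^+ 2 * B)) (e / B).
Proof.
move=> g0; rewrite /coset_mx.
have c10 := unitsO_neq0 c1_unit; have c20 := unitsO_neq0 c2_unit.
have : A != 0 by rewrite mulf_neq0 ?invr_neq0.
have : B != 0 by rewrite mulf_neq0 ?invr_neq0.
move: A B => A' B' B0 A0.
apply: (can_inj (mulKmx (gsp4_unit (dmat A' B')))); rewrite gsp4_mulVK.
rewrite (gsp4M _ (dmat _ _)) (gsp4M _ (zetamat _ _)) toG_umat toG_zetamat// !toG_dmat//.
set U1 := (X in X *m _ *m _ *m _ = _); set U2 := (X in _ *m X *m _ *m _ = _).
set N := (X in _ *m _ *m X *m _ = _); set D := (X in _ *m _ *m _ *m X = _).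
have -> : U1 *m U2 = mx4 [:: [:: 1; a; b + a * e; c + a * b]; [:: 0; 1; e; b];
    [:: 0; 0; 1; - a]; [:: 0; 0; 0; 1]].
  apply/matrixP => i j; rewrite mxE sum_ord4 !mx4E.
  by elim/ord4_ind: i; elim/ord4_ind: j => /=; ring.
rewrite -mulmxA; have -> : N *m D = mx4 [:: [:: g * alpha ^+ 2 * beta; 0; 0; 0];
    [:: 0; g * (alpha * beta); 0; 0]; [:: 0; x * (alpha * beta); alpha; 0];
    [:: 0; 0; 0; 1]].
  apply/matrixP => i j; rewrite mxE sum_ord4 !mx4E.
  by elim/ord4_ind: i; elim/ord4_ind: j => /=; ring.
apply/matrixP => i j; rewrite mxE [RHS]mxE !sum_ord4 !mx4E.
by elim/ord4_ind: i; elim/ord4_ind: j => /=; field; rewrite ?A0 ?B0.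
Qed.

Lemma whittaker_zetamat (g x : F) : g != 0 ->
  whittaker dx dg w psi t sgn c1 c2 (raction (dmat alpha beta) (fmin w psi t sgn))
    (zetamat g x) =
  if [&& vabs (alpha / A - 1) < 1, vabs (g * beta / B - 1) < 1 & vabs (x * beta) < 1]
  then (fq F ^+ 7)%:C%C else 0.
Proof.
move=> g0; have c10 := unitsO_neq0 c1_unit; have c20 := unitsO_neq0 c2_unit.
have A0 : A != 0 by rewrite mulf_neq0 ?invr_neq0.
have B0 : B != 0 by rewrite mulf_neq0 ?invr_neq0.
have vA : vabs A = fq F by rewrite vabsM !vabsV c1_unit (uniformizer_vabs w_unif) invrK invr1 mulr1.
have vB : vabs B = fq F by rewrite vabsM !vabsV c2_unit (uniformizer_vabs w_unif) invrK invr1 mulr1.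
have vAB : vabs (A * B) = fq F ^+ 2 by rewrite vabsM vA vB expr2.
have vAAB : vabs (A ^+ 2 * B) = fq F ^+ 3 by rewrite vabsM vabsX vA vB -exprSr.
set cond := [&& _, _ & _].
pose ball (d : F) : set F := [set y : F | vabs y <= vabs d].
pose box : set (borel F * borel F * borel F * borel F) :=
  ((ball A `*` ball (A * B)%R) `*` ball (A ^+ 2 * B)%R) `*` ball B.
have mball d : d != 0 -> measurable (ball d : set (borel F)).
  move=> d0; apply: (@borel_open F); have := @open_closed_ball R F 0 (vabs d).
  by under eq_set do rewrite subr0; apply; rewrite vabs_gt0.
have AB0 : A * B != 0 by rewrite mulf_neq0.
have AAB0 : A ^+ 2 * B != 0 by rewrite mulf_neq0 ?expf_neq0.
have mbox1 : measurable (ball A `*` ball (A * B)%R : set (borel F * borel F)).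
  by apply: measurableX; apply: mball.
have mbox2 : measurable ((ball A `*` ball (A * B)%R) `*` ball (A ^+ 2 * B)%R :
    set (borel F * borel F * borel F)).
  by apply: measurableX => //; apply: mball.
have mbox : measurable box by apply: measurableX => //; apply: mball.
(* The radii of the four balls are q, q^2, q^3 and q. *)
have box_vol : (dx \x dx \x dx \x dx)%E box = (fq F ^+ 7)%:E.
  rewrite /box product_measure1E//; last exact: mball.
  rewrite [X in (X * _)%E]product_measure1E//; last exact: mball.
  rewrite [X in (X * _ * _)%E]product_measure1E//; [|exact: mball..].
  rewrite !(haar_ball dx_haar)// vA vB vAB vAAB -!EFinM; congr (_%:E); ring.
have inball (y d : F) : d != 0 -> (vabs (y / d) <= 1) = (vabs y <= vabs d).
  by move=> d0; rewrite vabsM vabsV ler_pdivrMr ?vabs_gt0// mul1r.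
rewrite /whittaker (@eq_cintegral _ _ _ _ _ _ (fun u => if u \in box then (cond%:R : R[i]) else 0)).
  rewrite cintegral_if// setTI [X in fine X]box_vol /=.
  by case: cond; rewrite ?mul1r ?mul0r.
move=> [[[a b] c] e] _.
rewrite (_ : raction _ (raction _ _) =
  raction (umat (a : F) b c e * zetamat g x * dmat alpha beta)%g (fmin w psi t sgn)); last first.
  by apply/funext => y; rewrite /raction !mulgA.
have YE := @matrix_coefficient g x a b c e g0.
set y := (_^-1 * _)%g in YE; rewrite -/A -/B.
rewrite (inner_product_fmin w_unif t_unit psi_char psi_o dg_haar) -/y; last first.
  by move=> /Hprime_last_row; rewrite YE /coset_mx !mx4E; exact.
have KE : Kprime y <-> cond /\ ((a, b, c, e) : borel F * borel F * borel F * borel F) \in box.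
  rewrite KprimeP YE; split=> [/coset_iwahori|H]; [|apply/coset_iwahori; move: H]; rewrite !inball// inE /box /ball /= /cond.
    by move=> [[-> -> ->] [-> -> -> ->]].
  by move=> [/and3P[-> -> ->] [[[-> ->] ->] ->]].
case: asboolP => [yK|yK].
  have [condT bT] := proj1 KE yK; rewrite condT bT.
  have yI : iwahori (gsp4_mx y) by apply/KprimeP.
  rewrite YE in yI; rewrite (psi0_eq w_unif psi_char psi_o (coset_affine_part YE yI)).
  (* Since A and B are the inverses of w c1 and w c2, division of a / A + e / B by w leaves the
     argument of the Whittaker character. *)
  rewrite /psi0 (_ : w^-1 * _ = c1 * a + c2 * e) ?mulfV ?(psi_neq0 psi_char)//.
  by rewrite /A /B !invfM !invrK; field.
rewrite mul0r; case: ifP => // bT; case condE : cond => //.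
by case: yK; apply/KE; rewrite condE.
Qed.

End Whittaker.

(** * The zeta integral *)

Section ComplexPower.
Context {R : realType}.
Implicit Types (x y : R) (s : R[i]).

Lemma cpowD x s1 s2 : 0 < x -> cpow x (s1 + s2) = cpow x s1 * cpow x s2.
Proof.
move=> x0; case: s1 => a1 b1; case: s2 => a2 b2; rewrite /cpow /=.
have x1 : x != 0 by rewrite gt_eqF.
rewrite powRD; last by rewrite x1 implybT.
rewrite mulrDl cosD sinD; apply/eqP; rewrite eq_complex /=.
by apply/andP; split; apply/eqP; ring.
Qed.

Lemma cpowM x y s : 0 < x -> 0 < y -> cpow (x * y) s = cpow x s * cpow y s.
Proof.
move=> x0 y0; case: s => a b; rewrite /cpow /= powRM ?ltW// lnM ?posrE//.
rewrite mulrDr cosD sinD; apply/eqP; rewrite eq_complex /=.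
by apply/andP; split; apply/eqP; ring.
Qed.

Lemma cpow_real x (r : R) : cpow x r%:C%C = (x `^ r)%:C%C.
Proof. by rewrite /cpow /= mul0r cos0 sin0 mulr1 mulr0. Qed.

Lemma cpowV x s : 0 < x -> cpow x^-1 s = cpow x (- s).
Proof.
move=> x0; case: s => a b; rewrite /cpow /= -powR_inv1 ?ltW// -powRrM mulN1r.
by rewrite ln_powR mulN1r mulrN mulNr.
Qed.

Lemma cpow_nat x (n : nat) : 0 <= x -> cpow x n%:R = (x ^+ n)%:C%C.
Proof. by move=> x0; rewrite -(rmorph_nat (real_complex R)) cpow_real powR_mulrn. Qed.

End ComplexPower.

Section ZetaIntegral.
Context {R : realType} {F : nonarchimedeanLocalField R}.
Variable eta : F -> R[i].
Hypothesis eta_char : multiplicative_character eta.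

Lemma eta1 : eta 1 = 1.
Proof.
apply: (mulfI (eta_char.1 _ (oner_neq0 F))).
by rewrite -eta_char.2 ?oner_neq0// !mulr1.
Qed.

Lemma etaV (x : F) : x != 0 -> eta x^-1 = (eta x)^-1.
Proof.
move=> x0; apply: (mulfI (eta_char.1 _ x0)).
by rewrite -eta_char.2 ?invr_neq0// mulfV// eta1 mulfV// eta_char.1.
Qed.

(** For exponent 0 the character is trivial on all units, and these contain 1 + p. *)
Lemma conductor_le1_trivial (n : nat) : conductor_exponent eta n ->
  n = 0%N \/ n = 1%N -> trivial_on (unitsP F 1) eta.
Proof.
move=> [etan _] [] nE; rewrite nE in etan => // x x1; apply: etan.
exact: unitsP1_vabs.
Qed.

End ZetaIntegral.

Theorem proposition3p4 (R : realType) (F : nonarchimedeanLocalField R)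
    (w : F) (w_unif : uniformizer w)
    (psi : F -> R[i]) (psi_char : additive_character psi)
    (psi_o : trivial_on (ringO F) psi)
    (psi_p : ~ trivial_on (idealP F (-1)) psi)
    (dx : {sigma_finite_measure set (borel F) -> \bar R})
    (dx_haar : additive_haar dx)
    (dmx : {measure set (borel F) -> \bar R})
    (dmx_haar : multiplicative_haar dmx)
    (dg : {measure set (borel (ZbackslashG F)) -> \bar R})
    (dg_haar : quotient_haar dg)
    (t : F) (t_unit : unitsO F t) (sgn : bool)
    (c1 c2 : F) (c1_unit : unitsO F c1) (c2_unit : unitsO F c2)
    (alpha beta : F) (alpha_neq0 : alpha != 0) (beta_neq0 : beta != 0)
    (eta : F -> R[i]) (eta_char : multiplicative_character eta)
    (a : nat) (eta_cond : conductor_exponent eta a) (a01 : a = 0%N \/ a = 1%N)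
    (s : R[i]) :
  novodvorsky dx dmx s
    (whittaker dx dg w psi t sgn c1 c2
       (raction (dmat alpha beta) (fmin w psi t sgn)))
    eta =
  if alpha \in [set w^-1 * c1^-1 * y | y in unitsP F 1] then
    (1 - (resq F)%:R^-1)^-1 * cpow (fq F) (s + 7%:R / 2%:R)
    * cpow (vabs beta) (2%:R^-1 - s) * (eta (beta * w * c2))^-1
  else 0.
Proof.
have w0 := uniformizer_neq0 w_unif; have vw := uniformizer_vabs w_unif.
have c10 := unitsO_neq0 c1_unit; have c20 := unitsO_neq0 c2_unit.
have q1 := @fq_gt1 R F; have q0 := @fq_gt0 R F.
have b0 : 0 < vabs beta by rewrite vabs_gt0.
have A0 : w^-1 * c1^-1 != 0 by rewrite mulf_neq0 ?invr_neq0.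
have cosetP (d x : F) : d != 0 ->
    (x \in [set d * y | y in unitsP F 1]) = (vabs (x / d - 1) < 1).
  move=> d0; apply/idP/idP; rewrite inE.
    by move=> [y /unitsP1E y1 <-]; rewrite mulrAC mulfV// mul1r.
  by move=> xd; exists (x / d); [apply/unitsP1E|rewrite mulrC divfK].
pose B := w^-1 * c2^-1; have B0 : B != 0 by rewrite mulf_neq0 ?invr_neq0.
(* The condition on gamma says that gamma beta / B is in 1 + p, that is, gamma lies in the coset of
   [d]. *)
pose d := B / beta; have d0 : d != 0 by rewrite mulf_neq0 ?invr_neq0.
have vd : vabs d = fq F * (vabs beta)^-1.
  by rewrite !vabsM !vabsV vw c2_unit invrK invr1 mulr1.
rewrite /novodvorsky cosetP//; set cond := vabs (alpha / _ - 1) < 1.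
(* By discreteness this closed ball is the set where |x beta| < 1. *)
pose ball : set F := [set x : F | vabs x <= vabs (w / beta)].
have wb0 : w / beta != 0 by rewrite mulf_neq0 ?invr_neq0.
have mball : measurable (ball : set (borel F)).
  apply: (@borel_open F); have := @open_closed_ball R F 0 (vabs (w / beta)).
  by under eq_set do rewrite subr0; apply; rewrite vabs_gt0.
(* The part of the integrand left after the conditions on x and gamma are removed. It is constant on
   the coset of [d], because elements of 1 + p have absolute value 1 and [eta] is trivial on
   them. *)
pose C (g : F) : R[i] :=
  if cond then (fq F ^+ 7)%:C%C * cpow (vabs g) (s - 3%:R / 2%:R) * eta g else 0.
pose coset : set F := [set d * y | y in unitsP F 1].
have coset_const g : coset g -> C g = C d.
  move=> [y y1 <-]; have yu := unitsP1_vabs y1.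
  have y0 : y != 0 by rewrite -vabs_gt0 yu.
  rewrite /C vabsM yu mulr1 eta_char.2//.
  by rewrite (conductor_le1_trivial eta_cond a01 y1) mulr1.
have inner (g : F) : g != 0 ->
  cintegral dx setT (fun x : borel F =>
    whittaker dx dg w psi t sgn c1 c2 (raction (dmat alpha beta) (fmin w psi t sgn))
      (zetamat g x) * cpow (vabs g) (s - 3%:R / 2%:R) * eta g) =
  if g \in coset then C d * (vabs (w / beta))%:C%C else 0.
  move=> g0; rewrite (@eq_cintegral _ _ _ _ _ _ (fun x : borel F =>
      if x \in ball then (if g \in coset then C d else 0) else 0)).
    rewrite cintegral_if// setTI [X in fine X](haar_ball dx_haar)//=.
    by case: ifP => _; rewrite ?mul0r.
  move=> x _; rewrite (whittaker_zetamat w_unif t_unit psi_char psi_o dg_haar dx_haar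
    _ c1_unit c2_unit alpha_neq0 beta_neq0)// -/cond.
  have -> : (vabs (g * beta / (w^-1 * c2^-1) - 1) < 1) = (g \in coset).
    rewrite /coset cosetP// /d -/B; congr (vabs (_ - 1) < 1).
    by rewrite [in RHS]invf_div mulrA.
  rewrite [X in [&& _, _ & X]](_ : _ = (x \in ball)); last first.
    by apply/idP/idP; rewrite inE /ball /= vabs_lt1 !vabsM vabsV vw ler_pdivlMr.
  case: (x \in ball); rewrite ?andbF ?mul0r// andbT.
  case: (boolP (g \in coset)) => [gc|_]; rewrite ?andbF ?mul0r// andbT.
  rewrite -(coset_const g); last by rewrite inE in gc.
  by rewrite /C; case: ifP => _; rewrite ?mul0r.
rewrite (@eq_cintegral _ _ _ _ _ _ (fun g : borel F =>
    if g \in coset then C d * (vabs (w / beta))%:C%C else 0)); last first.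
  by move=> g; rewrite inE => g0; exact: inner.
have mcoset : measurable (coset : set (borel F)).
  by apply: (@borel_open F); exact: open_unit_coset.
rewrite cintegral_if//; last by apply: (@borel_open F); exact: open_neq0.
have -> : [set x : F | x != 0] `&` coset = coset.
  apply: setIidr => _ [y y1 <-] /=; rewrite mulf_neq0//.
  by rewrite -vabs_gt0 (unitsP1_vabs y1).
rewrite [X in fine X](haar_unit_coset dmx_haar)// /C; case: ifP => _; last by rewrite !mul0r.
rewrite vd (_ : d = (beta * w * c2)^-1); last by rewrite /d /B !invfM; ring.
rewrite (etaV eta_char) ?mulf_neq0// cpowM ?invr_gt0// cpowV//.
rewrite vabsM vabsV vw /=.
(* The power of |d| supplies the exponent s - 3/2, and 7/2 + 3/2 = 5. *)
have cq : cpow (fq F) (s + 7%:R / 2%:R) =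
    cpow (fq F) (s - 3%:R / 2%:R) * (fq F ^+ 5)%:C%C.
  by rewrite -cpow_nat ?ltW// -cpowD//; congr cpow; field.
have cb : cpow (vabs beta) (2%:R^-1 - s) =
    cpow (vabs beta) (- (s - 3%:R / 2%:R)) * ((vabs beta)^-1)%:C%C.
  rewrite -[(vabs beta)^-1]expr1 -cpow_nat ?invr_ge0 ?ltW// cpowV// -cpowD//.
  by congr cpow; field.
have c1q : (1 - (resq F)%:R^-1)^-1 = ((1 - (fq F)^-1)^-1)%:C%C :> R[i].
  by rewrite fmorphV rmorphB rmorph1 fmorphV rmorph_nat.
(* On the left: the constant q^7 of the Whittaker function, the volume of the ball of x, and the
   volume of the coset of gamma. *)
have real_eq : fq F ^+ 7 * ((fq F)^-1 / vabs beta) * (fq F - 1)^-1 =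
    (1 - (fq F)^-1)^-1 * fq F ^+ 5 * (vabs beta)^-1.
  by field; rewrite subr_eq0 !gt_eqF.
rewrite cq cb c1q; move: real_eq; move: (fq F ^+ 7) (fq F ^+ 5) => q7 q5 real_eq.
have := congr1 (real_complex R) real_eq; rewrite !rmorphM => E.
set X := cpow _ _; set Y := cpow _ (- _); set e := eta _.
transitivity (X * Y / e * (q7%:C%C * ((fq F)^-1%:C%C * (vabs beta)^-1%:C%C)
    * (fq F - 1)^-1%:C%C)); first by ring.
by rewrite E; ring.
Qed.
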